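(* Let $(\mathbb{R}^n,g)$ be a pseudo-Euclidean space, $n\geq 3$, with coordinates $x=(x_1,\dots,x_n)$ and $g_{ij}=\delta_{ij}\varepsilon_i$, $\varepsilon_i\in\{1,-1\}$. Let $f,\varphi:\mathbb{R}^n\to\mathbb{R}$ be smooth functions with $f$ positive and $\varphi$ nowhere vanishing, let $\overline{g}=\frac{1}{\varphi^2}g$, and let $(F^m,g_F)$, $m\geq 1$, be a semi-Riemannian Einstein manifold with constant Ricci curvature $\lambda_F$. Let $\lambda\in\mathbb{R}$. Consider the warped product $M=(\mathbb{R}^n,\overline{g})\times_f F^m$. Then the warped product metric $\widetilde g=\overline g+f^2g_F$ is Einstein with constant Ricci curvature $\lambda$ if and only if $f$ and $\varphi$ satisfy the following three conditions: for all $i\neq j$, $$(n-2)f\varphi_{,x_ix_j}-m\varphi f_{,x_ix_j}-m\varphi_{,x_i}f_{,x_j}-m\varphi_{,x_j}f_{,x_i}=0;$$ for all $i$, $$\varphi\big[(n-2)f\varphi_{,x_ix_i}-m\varphi f_{,x_ix_i}-2m\varphi_{,x_i}f_{,x_i}\big]+\varepsilon_i\Big[f\varphi\sum_{k=1}^n\varepsilon_k\varphi_{,x_kx_k}-(n-1)f\sum_{k=1}^n\varepsilon_k\varphi_{,x_k}^2+m\varphi\sum_{k=1}^n\varepsilon_k\varphi_{,x_k}f_{,x_k}\Big]=\varepsilon_i\lambda f;$$ and $$-f\varphi^2\sum_{k=1}^n\varepsilon_kf_{,x_kx_k}+(n-2)f\varphi\sum_{k=1}^n\varepsilon_kf_{,x_k}\varphi_{,x_k}-(m-1)\varphi^2\sum_{k=1}^n\varepsilon_kf_{,x_k}^2=\lambda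 f^2-\lambda_F.$$
   Context: A semi-Riemannian manifold $(N,h)$ is Einstein with constant Ricci curvature $\lambda\in\mathbb{R}$ if $\mathrm{Ric}_h=\lambda h$. For semi-Riemannian manifolds $(B,g_B)$, $(F,g_F)$ and a smooth function $f>0$ on $B$, the warped product $B\times_fF$ is the product manifold $B\times F$ with the metric $g_B+f^2g_F$ (pullbacks by the projections being understood). When $m=1$, the fiber is $F=\mathbb{R}$ and $\lambda_F=0$. The notation $\varphi_{,x_i}$, $\varphi_{,x_ix_j}$ denotes first and second partial derivatives. *)

(* Defs.v *)
From HB Require Import structures.
From mathcomp Require Import all_boot all_order all_algebra.
From mathcomp Require Import all_classical all_reals all_analysis.
Set Implicit Arguments.
Unset Strict Implicit.
Unset Printing Implicit Defensive.
Import Order.TTheory GRing.Theory Num.Theory.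
Import numFieldNormedType.Exports.
Local Open Scope classical_set_scope.
Local Open Scope ring_scope.

Definition pderiv (R : realType) (n : nat) (i : 'I_n) (f : 'rV[R]_n -> R) :
  'rV[R]_n -> R := 'D_(delta_mx 0 i) f.

(* meant for an open set U *)
Fixpoint Ck (R : realType) (n k : nat) (U : set 'rV[R]_n)
    (f : 'rV[R]_n -> R) : Prop :=
  (forall x, U x -> {for x, continuous f}) /\
  (if k is k'.+1 then
     (forall i x, U x -> derivable f x (delta_mx 0 i)) /\
     (forall i, Ck k' U (pderiv i f))
   else True).

Definition smooth_on (R : realType) (n : nat) (U : set 'rV[R]_n)
  (f : 'rV[R]_n -> R) : Prop := forall k, Ck k U f.

(* row-vector convention: row i holds the partial derivatives along x_i *)
Definition jacobian_mx (R : realType) (n : nat) (tau : 'rV[R]_n -> 'rV[R]_n)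
  (x : 'rV[R]_n) : 'M[R]_n := \matrix_(i, j) pderiv i (fun y => tau y 0 j) x.

(* A manifold is given by an atlas: [mf_coord a] maps the open set [mf_dom a]
   homeomorphically onto the open set [mf_img a] of R^n, with inverse
   [mf_param a].  Both maps are total; values off these sets are irrelevant. *)
Record manifold (R : realType) (n : nat) := Manifold {
  mf_pt :> topologicalType;
  mf_chart : Type;
  mf_dom : mf_chart -> set mf_pt;
  mf_img : mf_chart -> set 'rV[R]_n;
  mf_coord : mf_chart -> mf_pt -> 'rV[R]_n;
  mf_param : mf_chart -> 'rV[R]_n -> mf_pt;
  mf_nonempty : [set: mf_pt] !=set0;
  mf_hausdorff : hausdorff_space mf_pt;
  mf_second_countable : @second_countable mf_pt;
  mf_dom_open : forall a, open (mf_dom a);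
  mf_img_open : forall a, open (mf_img a);
  mf_coord_img : forall a p, mf_dom a p -> mf_img a (mf_coord a p);
  mf_param_dom : forall a x, mf_img a x -> mf_dom a (mf_param a x);
  mf_coordK : forall a p, mf_dom a p -> mf_param a (mf_coord a p) = p;
  mf_paramK : forall a x, mf_img a x -> mf_coord a (mf_param a x) = x;
  mf_coord_cont : forall a p, mf_dom a p -> {for p, continuous (mf_coord a)};
  mf_param_cont : forall a x, mf_img a x -> {for x, continuous (mf_param a)};
  mf_cover : forall p, exists a, mf_dom a p;
  mf_transition_smooth : forall a b j,
    smooth_on [set x | mf_img a x /\ mf_dom b (mf_param a x)]
              (fun x => mf_coord b (mf_param a x) 0 j)
}.

Arguments mf_dom_open {R n m} a.
Arguments mf_img_open {R n m} a.

Definition smooth_fun (R : realType) (n : nat) (M : manifold R n)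
  (f : M -> R) : Prop :=
  forall a : mf_chart M, smooth_on (mf_img a) (fun x => f (mf_param a x)).

(* nu is the number of timelike vectors in an orthonormal basis (the rows of P)
   of the symmetric bilinear form with Gram matrix G *)
Definition has_index (R : realType) (n : nat) (G : 'M[R]_n) (nu : nat) : Prop :=
  exists (P : 'M[R]_n) (s : {set 'I_n}),
    [/\ P \in unitmx, #|s| = nu &
        P *m G *m P^T = diag_mx (\row_i (if i \in s then -1 else 1))].

(* [sr_metric a x i j] is the component g_ij, in the chart a, of the metric at
   the point of coordinates x; [sr_change] is the tensor transformation law. *)
Record semiRiemannian (R : realType) (n : nat) := SemiRiemannian {
  sr_mf :> manifold R n;
  sr_metric : mf_chart sr_mf -> 'rV[R]_n -> 'M[R]_n;
  sr_smooth : forall a i j,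
    smooth_on (mf_img a) (fun x => sr_metric a x i j);
  sr_sym : forall a x, mf_img a x -> (sr_metric a x)^T = sr_metric a x;
  sr_nondeg : forall a x, mf_img a x -> sr_metric a x \in unitmx;
  sr_index : exists nu, forall a x, mf_img a x -> has_index (sr_metric a x) nu;
  sr_change : forall a b x, mf_img a x -> mf_dom b (mf_param a x) ->
    let tau y := mf_coord b (mf_param a y) in
    sr_metric a x = jacobian_mx tau x *m sr_metric b (tau x)
                    *m (jacobian_mx tau x)^T
}.

Section Curvature.
Variables (R : realType) (n : nat) (g : 'rV[R]_n -> 'M[R]_n).

(* Gamma^k_ij of the Levi-Civita connection *)
Definition christoffel (k i j : 'I_n) (x : 'rV[R]_n) : R :=
  2^-1 * \sum_l invmx (g x) k l *
    (pderiv i (fun y => g y j l) x + pderiv j (fun y => g y i l) x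
     - pderiv l (fun y => g y i j) x).

(* component along d_l of R(d_i, d_j) d_k, where
   R(X, Y) = nabla_X nabla_Y - nabla_Y nabla_X - nabla_[X, Y] *)
Definition riemann (l i j k : 'I_n) (x : 'rV[R]_n) : R :=
  pderiv i (christoffel l j k) x - pderiv j (christoffel l i k) x
  + \sum_p (christoffel l i p x * christoffel p j k x
            - christoffel l j p x * christoffel p i k x).

(* Ric(Y, Z) is the trace of X |-> R(X, Y) Z *)
Definition ricci (x : 'rV[R]_n) : 'M[R]_n :=
  \matrix_(j, k) \sum_i riemann i i j k x.

End Curvature.

(* Ric = lam g: an equality of tensors, so it is checked on components in each
   chart of the atlas *)
Definition einstein (R : realType) (n : nat) (M : semiRiemannian R n)
  (lam : R) : Prop :=
  forall (a : mf_chart M) x, mf_img a x ->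
    ricci (sr_metric a) x = lam *: sr_metric a x.

Section CkTheory.
Variable R : realType.

Lemma Ck_cont n k (U : set 'rV[R]_n) f :
  Ck k U f -> forall x, U x -> {for x, continuous f}.
Proof. by case: k => [|k] []. Qed.

Lemma Ck_drop n k (U : set 'rV[R]_n) f : Ck k.+1 U f -> Ck k U f.
Proof.
elim: k f => [|k IH] f [cf [df Df]]; first by split.
split=> //; split=> // i; exact: IH (Df i).
Qed.

Lemma Ck_sub n k (U V : set 'rV[R]_n) f : V `<=` U -> Ck k U f -> Ck k V f.
Proof.
move=> VU; elim: k f => [|k IH] f /=.
  by move=> [cf _]; split=> // x /VU; exact: cf.
move=> [cf [df Df]]; split; first by move=> x /VU; exact: cf.
split; first by move=> i x /VU; exact: df.
by move=> i; exact: IH.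
Qed.

Lemma near_continuous_at (T T' : topologicalType) (f g : T -> T') (x : T) :
  {near x, f =1 g} -> {for x, continuous f} -> {for x, continuous g}.
Proof.
move=> fg cf; rewrite /prop_for /continuous_at -(nbhs_singleton fg).
by apply: cvg_trans cf; exact: near_eq_cvg.
Qed.

Lemma Ck_ext n k (U : set 'rV[R]_n) f g : open U ->
  (forall x, U x -> f x = g x) -> Ck k U f -> Ck k U g.
Proof.
move=> oU; elim: k f g => [|k IH] f g fg.
  move=> [cf _]; split=> // x Ux; apply: near_continuous_at (cf _ Ux).
  by have := open_nbhs_nbhs (conj oU Ux); apply: filterS.
have nfg x : U x -> {near x, f =1 g}.
  by move=> Ux; have := open_nbhs_nbhs (conj oU Ux); apply: filterS.
move=> [cf [df Df]]; split.
  by move=> x Ux; apply: near_continuous_at (cf _ Ux); exact: nfg.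
split; first by move=> i x Ux; apply: (near_eq_derivable (nfg _ Ux)); exact: df.
move=> i; apply: (IH _ _ _ (Df i)) => x Ux; exact: near_eq_derive (nfg _ Ux).
Qed.

Lemma pderiv_cst n (i : 'I_n) (c : R) : pderiv i (fun=> c) = fun=> 0.
Proof. by apply/funext => x; exact: derive_cst. Qed.

Lemma Ck_cst n k (U : set 'rV[R]_n) (c : R) : Ck k U (fun=> c).
Proof.
elim: k c => [|k IH] c /=; first by split=> // x _; exact: cst_continuous.
split; first by move=> x _; exact: cst_continuous.
split; first by move=> i x _; exact: derivable_cst.
by move=> i; rewrite pderiv_cst.
Qed.

Lemma Ck_D n k (U : set 'rV[R]_n) f g : open U ->
  Ck k U f -> Ck k U g -> Ck k U (fun x => f x + g x).
Proof.
move=> oU; elim: k f g => [|k IH] f g.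
  by move=> [cf _] [cg _]; split=> // x Ux; exact: (continuousD (cf _ Ux) (cg _ Ux)).
move=> [cf [df Df]] [cg [dg Dg]]; split.
  by move=> x Ux; exact: (continuousD (cf _ Ux) (cg _ Ux)).
split; first by move=> i x Ux; apply: derivableD; [exact: df|exact: dg].
move=> i; apply: (Ck_ext oU _ (IH _ _ (Df i) (Dg i))) => x Ux.
by rewrite /pderiv deriveD//; [exact: df|exact: dg].
Qed.

Lemma Ck_M n k (U : set 'rV[R]_n) f g : open U ->
  Ck k U f -> Ck k U g -> Ck k U (fun x => f x * g x).
Proof.
move=> oU; elim: k f g => [|k IH] f g Cf Cg.
  case: Cf Cg => [cf _] [cg _].
  by split=> // x Ux; exact: (continuousM (cf _ Ux) (cg _ Ux)).
have [cf [df Df]] := Cf; have [cg [dg Dg]] := Cg; split.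
  by move=> x Ux; exact: (continuousM (cf _ Ux) (cg _ Ux)).
split; first by move=> i x Ux; apply: derivableM; [exact: df|exact: dg].
move=> i; apply: (Ck_ext oU _
  (Ck_D oU (IH _ _ (Ck_drop Cf) (Dg i)) (IH _ _ (Ck_drop Cg) (Df i)))) => x Ux.
by rewrite /pderiv deriveM//; [exact: df|exact: dg].
Qed.

Lemma Ck_V n k (U : set 'rV[R]_n) f : open U -> (forall x, U x -> f x != 0) ->
  Ck k U f -> Ck k U (fun x => (f x)^-1).
Proof.
move=> oU f0; elim: k => [|k IH] Cf.
  by case: Cf => cf _; split=> // x Ux; exact: (continuousV (f0 _ Ux) (cf _ Ux)).
have [cf [df Df]] := Cf; split.
  by move=> x Ux; exact: (continuousV (f0 _ Ux) (cf _ Ux)).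
split; first by move=> i x Ux; apply: derivableV; [exact: f0|exact: df].
move=> i; have CV := IH (Ck_drop Cf).
apply: (Ck_ext oU _ (Ck_M oU (Ck_cst k U (-1))
  (Ck_M oU (Ck_M oU CV CV) (Df i)))) => x Ux.
rewrite /pderiv deriveV; [|exact: f0|exact: df].
by rewrite -expr2 exprVn mulN1r -mulNr.
Qed.

Lemma continuous_lsubmx n m : continuous (@lsubmx R 1 n m).
Proof.
move=> z A [P Pz PA].
exists (fun i (j : 'I_(n + m)) => match fintype.split j with inl k => P i k | inr _ => setT end).
  move=> i j; case: splitP => k jk; last exact: filterT.
  by have := Pz i k; rewrite mxE; congr (nbhs (z i _) _); apply: val_inj.
move=> y Py; apply: PA => i k; have := Py i (lshift m k).
by rewrite (unsplitK (inl k)) mxE.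
Qed.

Lemma continuous_rsubmx n m : continuous (@rsubmx R 1 n m).
Proof.
move=> z A [P Pz PA].
exists (fun i (j : 'I_(n + m)) => match fintype.split j with inl _ => setT | inr k => P i k end).
  move=> i j; case: splitP => k jk; first exact: filterT.
  by have := Pz i k; rewrite mxE; congr (nbhs (z i _) _); apply: val_inj.
move=> y Py; apply: PA => i k; have := Py i (rshift n k).
by rewrite (unsplitK (inr k)) mxE.
Qed.

Lemma lsubmx_delta_l n m (i : 'I_n) :
  lsubmx (delta_mx 0 (lshift m i) : 'rV[R]_(n + m)) = delta_mx 0 i.
Proof. by apply/rowP => j; rewrite !mxE eq_lshift. Qed.

Lemma lsubmx_delta_r n m (i : 'I_m) :
  lsubmx (delta_mx 0 (rshift n i) : 'rV[R]_(n + m)) = 0.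
Proof. by apply/rowP => j; rewrite !mxE eq_lrshift andbF. Qed.

Lemma rsubmx_delta_l n m (i : 'I_n) :
  rsubmx (delta_mx 0 (lshift m i) : 'rV[R]_(n + m)) = 0.
Proof. by apply/rowP => j; rewrite !mxE eq_rlshift andbF. Qed.

Lemma rsubmx_delta_r n m (i : 'I_m) :
  rsubmx (delta_mx 0 (rshift n i) : 'rV[R]_(n + m)) = delta_mx 0 i.
Proof. by apply/rowP => j; rewrite !mxE eq_rshift. Qed.

Lemma quot_lsubmx n m (f : 'rV[R]_n -> R) (z v : 'rV[R]_(n + m)) :
  (fun h : R => h^-1 *: (((f \o lsubmx) \o shift z) (h *: v) - (f \o lsubmx) z))
  = (fun h => h^-1 *: ((f \o shift (lsubmx z)) (h *: lsubmx v) - f (lsubmx z))).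
Proof.
apply/funext => h; congr (_ *: (f _ - _)).
by apply/rowP => j; rewrite !mxE.
Qed.

Lemma quot_rsubmx n m (f : 'rV[R]_m -> R) (z v : 'rV[R]_(n + m)) :
  (fun h : R => h^-1 *: (((f \o rsubmx) \o shift z) (h *: v) - (f \o rsubmx) z))
  = (fun h => h^-1 *: ((f \o shift (rsubmx z)) (h *: rsubmx v) - f (rsubmx z))).
Proof.
apply/funext => h; congr (_ *: (f _ - _)).
by apply/rowP => j; rewrite !mxE.
Qed.

Lemma derive_lsubmx n m (f : 'rV[R]_n -> R) (z v : 'rV[R]_(n + m)) :
  'D_v (f \o lsubmx) z = 'D_(lsubmx v) f (lsubmx z).
Proof. by rewrite /derive quot_lsubmx. Qed.

Lemma derive_rsubmx n m (f : 'rV[R]_m -> R) (z v : 'rV[R]_(n + m)) :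
  'D_v (f \o rsubmx) z = 'D_(rsubmx v) f (rsubmx z).
Proof. by rewrite /derive quot_rsubmx. Qed.

Lemma pderiv_lsubmx_l n m i (f : 'rV[R]_n -> R) :
  pderiv (lshift m i) (f \o lsubmx) = pderiv i f \o lsubmx.
Proof. by apply/funext => z; rewrite /pderiv derive_lsubmx lsubmx_delta_l. Qed.

Lemma pderiv_lsubmx_r n m i (f : 'rV[R]_n -> R) :
  pderiv (rshift n (i : 'I_m)) (f \o lsubmx) = fun=> 0.
Proof.
by apply/funext => z; rewrite /pderiv derive_lsubmx lsubmx_delta_r derive0.
Qed.

Lemma pderiv_rsubmx_l n m i (f : 'rV[R]_m -> R) :
  pderiv (lshift m (i : 'I_n)) (f \o rsubmx) = fun=> 0.
Proof.
by apply/funext => z; rewrite /pderiv derive_rsubmx rsubmx_delta_l derive0.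
Qed.

Lemma pderiv_rsubmx_r n m i (f : 'rV[R]_m -> R) :
  pderiv (rshift n i) (f \o rsubmx) = pderiv i f \o rsubmx.
Proof. by apply/funext => z; rewrite /pderiv derive_rsubmx rsubmx_delta_r. Qed.

Lemma Ck_lsubmx n m k (U : set 'rV[R]_n) f : Ck k U f ->
  Ck k [set z : 'rV[R]_(n + m) | U (lsubmx z)] (f \o lsubmx).
Proof.
have cl (g : 'rV[R]_n -> R) : (forall x, U x -> {for x, continuous g}) ->
    forall z : 'rV[R]_(n + m), U (lsubmx z) -> {for z, continuous (g \o lsubmx)}.
  move=> cg z Uz; apply: continuous_comp; first exact: continuous_lsubmx.
  exact: cg.
elim: k f => [|k IH] f; first by move=> [cf _]; split=> //; exact: cl.
move=> [cf [df Df]]; split; first exact: cl.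
split=> i.
  move=> z Uz; rewrite /derivable quot_lsubmx -/(derivable _ _ _).
  case: (split_ordP i) => j ->; first by rewrite lsubmx_delta_l; exact: df.
  by rewrite lsubmx_delta_r; exact: derivable0.
case: (split_ordP i) => j ->; first by rewrite pderiv_lsubmx_l; exact: (IH _ (Df j)).
by rewrite pderiv_lsubmx_r; exact: Ck_cst.
Qed.

Lemma Ck_rsubmx n m k (U : set 'rV[R]_m) f : Ck k U f ->
  Ck k [set z : 'rV[R]_(n + m) | U (rsubmx z)] (f \o rsubmx).
Proof.
have cl (g : 'rV[R]_m -> R) : (forall x, U x -> {for x, continuous g}) ->
    forall z : 'rV[R]_(n + m), U (rsubmx z) -> {for z, continuous (g \o rsubmx)}.
  move=> cg z Uz; apply: continuous_comp; first exact: continuous_rsubmx.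
  exact: cg.
elim: k f => [|k IH] f; first by move=> [cf _]; split=> //; exact: cl.
move=> [cf [df Df]]; split; first exact: cl.
split=> i.
  move=> z Uz; rewrite /derivable quot_rsubmx -/(derivable _ _ _).
  case: (split_ordP i) => j ->; last by rewrite rsubmx_delta_r; exact: df.
  by rewrite rsubmx_delta_l; exact: derivable0.
case: (split_ordP i) => j ->; last by rewrite pderiv_rsubmx_r; exact: (IH _ (Df j)).
by rewrite pderiv_rsubmx_l; exact: Ck_cst.
Qed.

Lemma pderiv_coord n (i j : 'I_n) :
  pderiv i (fun x : 'rV[R]_n => x 0 j) = fun=> (i == j)%:R.
Proof.
apply/funext => x; rewrite /pderiv /derive.
apply/lim_near_cst => //.
near=> h; have h0 : h != 0 by near: h; exact: nbhs_dnbhs_neq.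
by rewrite /= !mxE addrK eqxx /= [j == i]eq_sym /GRing.scale /= mulKf.
Unshelve. all: by end_near. Qed.

Lemma Ck_coord n k (U : set 'rV[R]_n) (j : 'I_n) : Ck k U (fun x => x 0 j).
Proof.
case: k => [|k]; first by split=> // x _; exact: coord_continuous.
split; first by move=> x _; exact: coord_continuous.
split; last by move=> i; rewrite pderiv_coord; exact: Ck_cst.
move=> i x _; apply: (is_cvg_near_cst ((i == j)%:R : R)).
near=> h; have h0 : h != 0 by near: h; exact: nbhs_dnbhs_neq.
by rewrite /= !mxE addrK eqxx /= [j == i]eq_sym /GRing.scale /= mulKf.
Unshelve. all: by end_near. Qed.

End CkTheory.

Section EuclideanManifold.
Variables (R : realType) (n : nat).

Lemma second_countable_rV : @second_countable 'rV[R]_n.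
Proof.
pose B (p : 'rV[rat]_n * nat) : set 'rV[R]_n :=
  ball (map_mx ratr p.1 : 'rV[R]_n) (p.2.+1%:R^-1 : R).
exists (range B).
  by apply: sub_countable (card_image_le _ _) _; exact: countableP.
split; first by move=> _ [p _ <-]; apply: ball_open; rewrite invr_gt0.
move=> x A /nbhs_ballP[e /= e0 xeA].
have e2 : 0 < e / 2 by rewrite divr_gt0.
have [k _ /(_ k)/(_ (leqnn _)) /= ke] := near_infty_natSinv_lt (PosNum e2).
have k0 : (0 : R) < k.+1%:R^-1 by rewrite invr_gt0.
have qP j : exists q : rat, ball (x 0 j) (k.+1%:R^-1 : R) (ratr q : R).
  have [|q] := @rat_in_itvoo R (x 0 j) (x 0 j + k.+1%:R^-1).
    by rewrite ltrDl.
  rewrite in_itv /= => /andP[xq qx]; exists q.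
  by rewrite /ball /= distrC gtr0_norm ?subr_gt0// ltrBlDl.
have [q qx] := choice qP.
have xq : ball (map_mx ratr (\row_j q j) : 'rV[R]_n) (k.+1%:R^-1 : R) x.
  by split=> // i j; rewrite ord1 !mxE; apply: ball_sym; exact: qx.
exists (B (\row_j q j, k)); first by split=> //; exists (\row_j q j, k).
move=> y /= qy; apply: xeA; apply: (@le_ball _ _ _ (k.+1%:R^-1 + k.+1%:R^-1)).
  by rewrite (splitr e) lerD// ltW.
by apply: ball_triangle qy; exact: ball_sym.
Qed.

Lemma euclidean_transition (a b : unit) (j : 'I_n) :
  smooth_on [set x : 'rV[R]_n | setT x /\ setT x] (fun x : 'rV[R]_n => x 0 j).
Proof. by move=> k; exact: Ck_coord. Qed.

(* R^n with the single chart id *)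
Definition euclidean : manifold R n :=
  @Manifold R n 'rV[R]_n unit (fun=> setT) (fun=> setT) (fun=> id) (fun=> id)
    (ex_intro _ 0 I) (@norm_hausdorff _ _) second_countable_rV
    (fun=> openT) (fun=> openT) (fun _ _ _ => I) (fun _ _ _ => I)
    (fun _ _ _ => erefl) (fun _ _ _ => erefl)
    (fun _ _ _ => @cvg_id _ _) (fun _ _ _ => @cvg_id _ _)
    (fun p => ex_intro _ tt I) euclidean_transition.

End EuclideanManifold.

Lemma has_index_unitmx (R : realType) n (G : 'M[R]_n) nu :
  has_index G nu -> G \in unitmx.
Proof.
move=> [P [s [Pu _ PG]]].
have : P *m G *m P^T \in unitmx.
  rewrite PG unitmxE det_diag; apply/unitr_prodP => i _; rewrite mxE.
  by case: ifP; rewrite ?unitrN unitr1.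
by rewrite !unitmx_mul => /andP[/andP[]].
Qed.

Section PseudoEuclidean.
Variables (R : realType) (n : nat) (eps : 'I_n -> R).
Hypothesis heps : forall i, eps i = 1 \/ eps i = -1.

Definition pseudo_euclidean_mx : 'M[R]_n := diag_mx (\row_i eps i).

Lemma pseudo_euclidean_index :
  has_index pseudo_euclidean_mx #|[set i | eps i == -1]%SET|.
Proof.
exists 1%:M, [set i | eps i == -1]%SET; split=> //; first exact: unitmx1.
rewrite mul1mx trmx1 mulmx1; congr diag_mx; apply/rowP => i; rewrite !mxE inE.
by case: eqP => //; case: (heps i).
Qed.

Lemma jacobian_id (x : 'rV[R]_n) : jacobian_mx (fun y => y) x = 1%:M.
Proof. by apply/matrixP => i j; rewrite !mxE pderiv_coord. Qed.

Program Definition pseudo_euclidean : semiRiemannian R n :=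
  @SemiRiemannian R n (euclidean R n) (fun _ _ => pseudo_euclidean_mx)
    _ _ _ _ _.
Next Obligation. by move=> a i j k; exact: Ck_cst. Qed.
Next Obligation. by move=> *; exact: tr_diag_mx. Qed.
Next Obligation. by move=> *; apply: has_index_unitmx pseudo_euclidean_index. Qed.
Next Obligation.
by exists #|[set i | eps i == -1]%SET| => *; exact: pseudo_euclidean_index.
Qed.
Next Obligation.
by move=> a b x _ _ /=; rewrite jacobian_id trmx1 mul1mx mulmx1.
Qed.

End PseudoEuclidean.

Section Conformal.
Variables (R : realType) (n : nat) (M : semiRiemannian R n) (phi : M -> R).
Hypothesis phi_smooth : smooth_fun phi.
Hypothesis phi_neq0 : forall p, phi p != 0.

(* phi^-2 g *)
Definition conformal_metric (a : mf_chart M) (x : 'rV[R]_n) : 'M[R]_n :=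
  (phi (mf_param a x)) ^- 2 *: sr_metric a x.

Lemma conformal_index nu a x : has_index (sr_metric a x) nu ->
  has_index (conformal_metric a x) nu.
Proof.
move=> [P [s [Pu sn PG]]]; exists (phi (mf_param a x) *: P), s; split=> //.
  by rewrite unitmxZ// unitfE.
rewrite -PG /conformal_metric [(_ *: P)^T]linearZ/= -!scalemxAl -!scalemxAr !scalerA.
by rewrite -scalemxAl scalerA -expr2 divff ?scale1r// expf_neq0.
Qed.

Program Definition conformal : semiRiemannian R n :=
  @SemiRiemannian R n M conformal_metric _ _ _ _ _.
Next Obligation.
move=> a i j k; have o := mf_img_open a.
have /= H := Ck_M o (Ck_V o _ (Ck_M o (phi_smooth a k) (phi_smooth a k)))
  (sr_smooth a i j k).
apply: Ck_ext o _ (H _) => x _; last by rewrite mulf_neq0.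
by rewrite mxE expr2.
Qed.
Next Obligation. by move=> a x ax; rewrite linearZ/= sr_sym. Qed.
Next Obligation.
move=> a x ax; have [nu nuP] := sr_index M.
exact/has_index_unitmx/conformal_index/nuP.
Qed.
Next Obligation.
by have [nu nuP] := sr_index M; exists nu => a x /nuP; exact: conformal_index.
Qed.
Next Obligation.
move=> a b x ax bx /=; rewrite /conformal_metric (sr_change ax bx) mf_coordK//.
by rewrite -scalemxAr -scalemxAl.
Qed.

End Conformal.

Section ProductManifold.
Variables (R : realType) (n m : nat) (M : manifold R n) (N : manifold R m).

Let chart : Type := (mf_chart M * mf_chart N)%type.

Definition prod_dom (c : chart) : set (M * N) :=
  [set p | mf_dom c.1 p.1 /\ mf_dom c.2 p.2].

Definition prod_img (c : chart) : set 'rV[R]_(n + m) :=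
  [set z | mf_img c.1 (lsubmx z) /\ mf_img c.2 (rsubmx z)].

Definition prod_coord (c : chart) (p : M * N) : 'rV[R]_(n + m) :=
  row_mx (mf_coord c.1 p.1) (mf_coord c.2 p.2).

Definition prod_param (c : chart) (z : 'rV[R]_(n + m)) : M * N :=
  (mf_param c.1 (lsubmx z), mf_param c.2 (rsubmx z)).

Lemma prod_nonempty : [set: M * N] !=set0.
Proof.
have [p _] := mf_nonempty M; have [q _] := mf_nonempty N.
by exists (p, q).
Qed.

Lemma prod_hausdorff : hausdorff_space (M * N)%type.
Proof.
move=> [p1 p2] [q1 q2] pq; congr pair.
  apply: (@mf_hausdorff R n M) => A B pA qB.
  have [||[z1 z2] [/= Az Bz]] := pq (A `*` setT) (B `*` setT).
  - by exists (A, setT) => //; split=> //; exact: filterT.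
  - by exists (B, setT) => //; split=> //; exact: filterT.
  by exists z1; case: Az; case: Bz.
apply: (@mf_hausdorff R m N) => A B pA qB.
have [||[z1 z2] [/= Az Bz]] := pq (setT `*` A) (setT `*` B).
- by exists (setT, A) => //; split=> //; exact: filterT.
- by exists (setT, B) => //; split=> //; exact: filterT.
by exists z2; case: Az; case: Bz.
Qed.

Lemma open_prodset (T T' : topologicalType) (A : set T) (B : set T') :
  open A -> open B -> open [set p : T * T' | A p.1 /\ B p.2].
Proof.
move=> oA oB; rewrite openE => -[p q] [/= Ap Bq].
by exists (A, B) => //; split; exact: open_nbhs_nbhs.
Qed.

Lemma prod_second_countable : @second_countable (M * N)%type.
Proof.
have [A cA [oA bA]] := mf_second_countable M.
have [B cB [oB bB]] := mf_second_countable N.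
pose f (U : set M * set N) : set (M * N) := [set p | U.1 p.1 /\ U.2 p.2].
exists (f @` (A `*` B)).
  apply: sub_countable (card_image_le _ _) _; exact: countableX.
split; first by move=> _ [[U V] [/oA + /oB +] <-]; exact: open_prodset.
move=> [p q] W [[U V] [/= /bA[U' [AU' pU'] U'U] /bB[V' [BV' qV'] V'V]] UVW].
exists (f (U', V')); first by split=> //; exists (U', V').
by move=> [x y] [/= U'x V'y]; apply: UVW; split; [exact: U'U|exact: V'V].
Qed.

Lemma prod_dom_open c : open (prod_dom c).
Proof. by apply: open_prodset; exact: mf_dom_open. Qed.

Lemma prod_img_open c : open (prod_img c).
Proof.
apply: openI; first by apply: open_comp (mf_img_open _) => z _;
  exact: continuous_lsubmx.
by apply: open_comp (mf_img_open _) => z _; exact: continuous_rsubmx.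
Qed.

Lemma prod_coord_cont c p : prod_dom c p -> {for p, continuous (prod_coord c)}.
Proof.
move=> [dp1 dp2] A [P Pz PA].
pose P1 i k := P i (lshift m k); pose P2 i k := P i (rshift n k).
exists ([set q | forall i k, P1 i k (mf_coord c.1 q i k)],
        [set q | forall i k, P2 i k (mf_coord c.2 q i k)]).
  split=> /=.
    suff h : nbhs (mf_coord c.1 p.1) [set x | forall i k, P1 i k (x i k)].
      exact: (mf_coord_cont dp1 h).
    by exists P1 => // i k; have := Pz i (lshift m k); rewrite row_mxEl.
  suff h : nbhs (mf_coord c.2 p.2) [set x | forall i k, P2 i k (x i k)].
    exact: (mf_coord_cont dp2 h).
  by exists P2 => // i k; have := Pz i (rshift n k); rewrite row_mxEr.
move=> q [/= Q1 Q2]; apply: PA => i j.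
case: (split_ordP j) => k ->.
  by have := Q1 i k; rewrite /prod_coord row_mxEl.
by have := Q2 i k; rewrite /prod_coord row_mxEr.
Qed.

Lemma prod_param_cont c z : prod_img c z -> {for z, continuous (prod_param c)}.
Proof.
move=> [z1 z2].
have h1 : {for z, continuous (mf_param c.1 \o lsubmx)}.
  by apply: continuous_comp; [exact: continuous_lsubmx|exact: mf_param_cont].
have h2 : {for z, continuous (mf_param c.2 \o rsubmx)}.
  by apply: continuous_comp; [exact: continuous_rsubmx|exact: mf_param_cont].
exact: (cvg_pair h1 h2).
Qed.

Lemma prod_transition c d j :
  smooth_on [set z | prod_img c z /\ prod_dom d (prod_param c z)]
    (fun z => prod_coord d (prod_param c z) 0 j).
Proof.
move=> k; case: (split_ordP j) => i ->.
  rewrite (_ : (fun z => prod_coord _ _ _ _) =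
    (fun x => mf_coord d.1 (mf_param c.1 x) 0 i) \o lsubmx); last first.
    by apply/funext => z; rewrite /prod_coord row_mxEl.
  have H := Ck_lsubmx m (@mf_transition_smooth R n M c.1 d.1 i k).
  apply: (Ck_sub _ H).
  by move=> z [[? ?] [? ?]].
rewrite (_ : (fun z => prod_coord _ _ _ _) =
  (fun x => mf_coord d.2 (mf_param c.2 x) 0 i) \o rsubmx); last first.
  by apply/funext => z; rewrite /prod_coord row_mxEr.
have H := Ck_rsubmx n (@mf_transition_smooth R m N c.2 d.2 i k).
apply: (Ck_sub _ H).
by move=> z [[? ?] [? ?]].
Qed.

Program Definition prod_manifold : manifold R (n + m) :=
  @Manifold R (n + m) (M * N)%type chart prod_dom prod_img prod_coord prod_param
    prod_nonempty prod_hausdorff prod_second_countable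
    prod_dom_open prod_img_open _ _ _ _ prod_coord_cont prod_param_cont _
    prod_transition.
Next Obligation.
by move=> c p [/= p1 p2]; split; rewrite /prod_coord ?row_mxKl ?row_mxKr;
  exact: mf_coord_img.
Qed.
Next Obligation. by move=> c z [z1 z2]; split; exact: mf_param_dom. Qed.
Next Obligation.
move=> c [p q] [/= p1 p2]; rewrite /prod_param /prod_coord row_mxKl row_mxKr.
by rewrite !mf_coordK.
Qed.
Next Obligation.
by move=> c z [z1 z2]; rewrite /prod_coord /= !mf_paramK// hsubmxK.
Qed.
Next Obligation.
move=> [p q]; have [a ap] := mf_cover p; have [b bq] := mf_cover q.
by exists (a, b).
Qed.

End ProductManifold.

Section WarpedProduct.
Variables (R : realType) (n m : nat).
Variables (B : semiRiemannian R n) (F : semiRiemannian R m) (f : B -> R).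
Hypothesis f_smooth : smooth_fun f.
Hypothesis f_gt0 : forall p, 0 < f p.

(* pi_B^* g_B + (f o pi_B)^2 pi_F^* g_F in a product chart *)
Definition warped_metric (c : mf_chart (prod_manifold B F))
    (z : 'rV[R]_(n + m)) : 'M[R]_(n + m) :=
  block_mx (sr_metric c.1 (lsubmx z)) 0
           0 ((f (mf_param c.1 (lsubmx z))) ^+ 2 *: sr_metric c.2 (rsubmx z)).

Lemma warped_index nu nu' c z :
  has_index (sr_metric c.1 (lsubmx z)) nu ->
  has_index (sr_metric c.2 (rsubmx z)) nu' ->
  has_index (warped_metric c z) (nu + nu').
Proof.
rewrite /warped_metric; set r := f _; have r0 : r != 0 by rewrite gt_eqF // f_gt0.
move=> [P [s [Pu sn PG]]] [Q [t [Qu tn QG]]].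
exists (block_mx P 0 0 (r^-1 *: Q)),
  ((@lshift n m @: s) :|: (@rshift n m @: t)); split.
- by rewrite unitmxE det_ublock unitrM -!unitmxE Pu /= unitmxZ ?unitfE ?invr_eq0.
- rewrite cardsU !card_imset ?sn ?tn; [|exact: rshift_inj|exact: lshift_inj].
  rewrite (_ : _ :&: _ = finset.set0) ?cards0 ?subn0//.
  apply/setP => i; rewrite !inE; apply/negP => /andP[/imsetP[j _ ->]].
  by move=> /imsetP[k _ /eqP]; rewrite eq_lrshift.
- rewrite tr_block_mx !trmx0 !mulmx_block !(mulmx0, mul0mx, addr0, add0r) PG.
  rewrite [(_ *: Q)^T]linearZ/= -!scalemxAl -!scalemxAr -!scalemxAl !scalerA.
  rewrite expr2 mulKf// mulVf// scale1r QG.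
  rewrite -diag_mx_row; congr diag_mx; apply/rowP => j.
  case: (split_ordP j) => i ->; rewrite ?row_mxEl ?row_mxEr !mxE !inE.
    rewrite mem_imset; last exact: lshift_inj.
    case: (i \in s) => //=; case: imsetP => // -[k _ /eqP].
    by rewrite eq_lrshift.
  rewrite orbC mem_imset; last exact: rshift_inj.
  case: (i \in t) => //=; case: imsetP => // -[k _ /eqP].
  by rewrite eq_rlshift.
Qed.

Lemma jacobian_prod (c d : mf_chart (prod_manifold B F)) z :
  jacobian_mx (fun y => mf_coord d (mf_param c y)) z =
  block_mx
    (jacobian_mx (fun y => mf_coord d.1 (mf_param c.1 y)) (lsubmx z)) 0
    0 (jacobian_mx (fun y => mf_coord d.2 (mf_param c.2 y)) (rsubmx z)).
Proof.
apply/matrixP => i j; rewrite mxE /=; case: (split_ordP j) => j' ->.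
  rewrite (_ : (fun y => _) =
      (fun x => mf_coord d.1 (mf_param c.1 x) 0 j') \o lsubmx); last first.
    by apply/funext => y; rewrite /prod_coord row_mxEl.
  case: (split_ordP i) => i' ->.
    by rewrite pderiv_lsubmx_l block_mxEul mxE.
  by rewrite pderiv_lsubmx_r block_mxEdl mxE.
rewrite (_ : (fun y => _) =
    (fun x => mf_coord d.2 (mf_param c.2 x) 0 j') \o rsubmx); last first.
  by apply/funext => y; rewrite /prod_coord row_mxEr.
case: (split_ordP i) => i' ->.
  by rewrite pderiv_rsubmx_l block_mxEur mxE.
by rewrite pderiv_rsubmx_r block_mxEdr mxE.
Qed.

Program Definition warped_product : semiRiemannian R (n + m) :=
  @SemiRiemannian R (n + m) (prod_manifold B F) warped_metric _ _ _ _ _.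
Next Obligation.
move=> c i j k.
have subl : prod_img c `<=` [set z | mf_img c.1 (lsubmx z)] by move=> z [].
have subr : prod_img c `<=` [set z | mf_img c.2 (rsubmx z)] by move=> z [].
have o := mf_img_open c.
case: (split_ordP i) => i' ->; case: (split_ordP j) => j' ->.
- apply: Ck_ext o _ (Ck_sub subl (Ck_lsubmx m (sr_smooth c.1 i' j' k))) => z _.
  by rewrite /warped_metric block_mxEul.
- apply: Ck_ext o _ (Ck_cst _ _ 0) => z _.
  by rewrite /warped_metric block_mxEur mxE.
- apply: Ck_ext o _ (Ck_cst _ _ 0) => z _.
  by rewrite /warped_metric block_mxEdl mxE.
- have Cf := Ck_sub subl (Ck_lsubmx m (f_smooth c.1 k)).
  have Cg := Ck_sub subr (Ck_rsubmx n (sr_smooth c.2 i' j' k)).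
  apply: Ck_ext o _ (Ck_M o (Ck_M o Cf Cf) Cg) => z _.
  by rewrite /warped_metric block_mxEdr mxE expr2.
Qed.
Next Obligation.
move=> c z [z1 z2]; rewrite /warped_metric tr_block_mx !trmx0 linearZ/=.
by rewrite !sr_sym.
Qed.
Next Obligation.
move=> c z [z1 z2]; have [nu nuP] := sr_index B; have [nu' nuP'] := sr_index F.
exact: has_index_unitmx (warped_index (nuP _ _ z1) (nuP' _ _ z2)).
Qed.
Next Obligation.
have [nu nuP] := sr_index B; have [nu' nuP'] := sr_index F.
by exists (nu + nu')%N => c z [z1 z2]; exact: warped_index (nuP _ _ z1) (nuP' _ _ z2).
Qed.
Next Obligation.
move=> c d z [c1 c2] [d1 d2] tau; rewrite /tau jacobian_prod /warped_metric.
rewrite tr_block_mx !trmx0 /= /prod_coord /= !row_mxKl !row_mxKr.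
rewrite !mulmx_block !(mulmx0, mul0mx, addr0, add0r) mf_coordK//.
by rewrite (sr_change c1 d1) (sr_change c2 d2) -scalemxAr -scalemxAl.
Qed.

End WarpedProduct.

(* Main.v *)
Require Import Defs.
From HB Require Import structures.
From mathcomp Require Import all_boot all_order all_algebra.
From mathcomp Require Import all_classical all_reals all_analysis.
From mathcomp Require Import ring.
Import Order.TTheory GRing.Theory Num.Theory.
Import numFieldNormedType.Exports.
Local Open Scope ring_scope.

(** The Ricci tensor of a warped product [B x_f F] with [dim F = m] splits as
    - [Ric_B - (m / f) Hess f] on pairs of base directions,
    - zero on mixed pairs,
    - [Ric_F - (f Lap f + (m - 1) |grad f|^2) g_F] on pairs of fiber directions,
    so being Einstein amounts to one tensor equation on the base and one on the
    fiber (lemma [ricci_warped_eqP]).  As [Ric_F = lamF g_F], every term of the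
    fiber equation is a multiple of [g_F]; since [g_F] is nondegenerate and
    [m >= 1], one of its entries is nonzero and can be cancelled, which leaves
    the scalar equation
    [lamF - f Lap f - (m - 1) |grad f|^2 = lam f^2].

    On the base, the metric [phi^-2 eps] is conformally flat.  Its Christoffel
    symbols are linear in the logarithmic derivatives [v_i = phi_i / phi], and
    contracting them gives (lemma [ricci_conformally_flat])
    [Ric_jk = (n - 2) phi_jk / phi + delta_jk eps_j
       (sum_i eps_i phi_ii / phi - (n - 1) sum_i eps_i phi_i^2 / phi^2)].
    Together with the Hessian, the gradient and the Laplacian of [f] for this
    metric, it turns the base equation, multiplied by [f phi^2], into the first
    condition off the diagonal (up to the nonzero factor [phi]) and into the
    second one on the diagonal (lemma [base_einsteinP]), and the fiber equation
    into the third.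

    The curvature is computed in coordinates, in a product chart.  Differentiating
    the Christoffel symbols of the conformally flat metric produces both
    [phi_jk] and [phi_kj], in the combination [(n - 1) phi_jk - phi_kj]; hence
    the symmetry of second derivatives is needed (lemma [pderivC]). *)

Set Implicit Arguments.
Unset Strict Implicit.

(** * Symmetry of mixed partial derivatives *)

Section MixedPartials.
Variables (R : realType) (n : nat).
Implicit Types (f : 'rV[R]_n -> R) (x y u v : 'rV[R]_n).

Lemma is_derive_line f y v (t : R) : derivable f (y + t *: v) v ->
  is_derive t 1 (fun s : R => f (y + s *: v)) ('D_v f (y + t *: v)).
Proof.
have quotE : (fun h : R => h^-1 *: (((fun s : R => f (y + s *: v)) \o shift t)
      (h *: (1 : R)) - f (y + t *: v))) =
    (fun h : R => h^-1 *: ((f \o shift (y + t *: v)) (h *: v) - f (y + t *: v))).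
  apply/funext => h; congr (_ *: (f _ - _)) => /=.
  by rewrite [h *: 1]mulr1 scalerDl addrCA addrC.
by move=> df; split; rewrite /derivable /derive quotE.
Qed.

Lemma mean_value_line f y v (h : R) : 0 < h ->
  (forall t : R, 0 <= t <= h -> derivable f (y + t *: v) v) ->
  exists2 c : R, 0 <= c <= h &
    f (y + h *: v) - f y = h * 'D_v f (y + c *: v).
Proof.
move=> h0 df; pose G (s : R) := f (y + s *: v).
have dG (t : R) : t \in `[0, h]%R -> is_derive t 1 G ('D_v f (y + t *: v)).
  by rewrite in_itv /= => /df; exact: is_derive_line.
have M := @MVT_segment R G (fun t => 'D_v f (y + t *: v)) 0 h (ltW h0).
have dGo (t : R) : t \in `]0, h[%R -> is_derive t 1 G ('D_v f (y + t *: v)).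
  by move=> th; apply: dG; apply: subset_itv_oo_cc th.
have cG : {within `[0, h]%classic, continuous G}%classic.
  by apply: derivable_within_continuous => t /dG[].
have [c ch Gc] := M dGo cG.
exists c; first by rewrite in_itv in ch.
by move: Gc; rewrite /G scale0r addr0 subr0 mulrC.
Qed.

(** The mean value theorem is applied twice: along [u] to
    [y |-> f (y + h v) - f y], then along [v] to ['D_u f].  Because the same
    second difference arises with [u] and [v] exchanged, this identifies
    [D_v D_u f] and [D_u D_v f] at two points of the parallelogram. *)
Lemma second_difference f x u v (h : R) (A : set 'rV[R]_n) : 0 < h ->
  (forall s t : R, 0 <= s <= h -> 0 <= t <= h -> A (x + s *: u + t *: v)) ->
  (forall y, A y -> derivable f y u) ->
  (forall y, A y -> derivable ('D_u f) y v) ->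
  exists2 p, A p & f (x + h *: u + h *: v) - f (x + h *: v)
    - (f (x + h *: u) - f x) = h ^+ 2 * 'D_v ('D_u f) p.
Proof.
move=> h0 Ah duf dvuf.
have hh : 0 <= h <= h by rewrite lexx ltW.
have h00 : 0 <= (0 : R) <= h by rewrite lexx ltW.
pose G (s : R) := f (x + h *: v + s *: u) - f (x + s *: u).
have dG (t : R) : t \in `[0, h]%R -> is_derive t 1 G
    ('D_u f (x + h *: v + t *: u) - 'D_u f (x + t *: u)).
  rewrite in_itv /= => th; apply: is_deriveB; apply: is_derive_line; apply: duf.
    by rewrite addrAC; exact: Ah.
  by rewrite -[X in A X]addr0 -(scale0r v); exact: Ah.
pose dGt (t : R) := 'D_u f (x + h *: v + t *: u) - 'D_u f (x + t *: u).
have M := @MVT_segment R G dGt 0 h (ltW h0).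
have dGo (t : R) : t \in `]0, h[%R -> is_derive t 1 G (dGt t).
  by move=> th; apply: dG; apply: subset_itv_oo_cc th.
have cG : {within `[0, h]%classic, continuous G}%classic.
  by apply: derivable_within_continuous => t /dG[].
have [c ch Gc] := M dGo cG.
rewrite in_itv /= in ch; move: Gc; rewrite /G scale0r !addr0 subr0 => Gc.
have [t th|d dh Gd] := @mean_value_line ('D_u f) (x + c *: u) v h h0.
  exact/dvuf/Ah.
exists (x + c *: u + d *: v); first exact: Ah.
rewrite expr2 -mulrA -Gd [x + h *: u + _]addrAC mulrC -[x + c *: u + _]addrAC -Gc.
ring.
Qed.

(** Both mixed derivatives are continuous at [x], and by [second_difference]
    they take a common value at two points as close to [x] as desired. *)
Lemma pderivC (U : set 'rV[R]_n) f x (i j : 'I_n) : open U -> Ck 2 U f -> U x ->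
  pderiv i (pderiv j f) x = pderiv j (pderiv i f) x.
Proof.
move=> oU [_ [df Df]] Ux.
have cont k l : {for x, continuous (pderiv k (pderiv l f))}.
  by have [_ [_ /(_ k)[+ _]]] := Df l; exact.
have close (a b c e : R) : `|a - c| < e / 2 -> `|b - c| < e / 2 -> `|a - b| < e.
  move=> ac bc; apply: (le_lt_trans (ler_distD c a b)).
  by rewrite [ltRHS]splitr ltrD// distrC.
suff dist_lt (e : R) : 0 < e ->
    `|pderiv i (pderiv j f) x - pderiv j (pderiv i f) x| < e.
  apply/eqP; rewrite -subr_eq0 -normr_eq0; apply/negPn/negP => N0.
  set d := `|_| in N0 dist_lt *; have := dist_lt d.
  by rewrite ltxx lt0r N0 normr_ge0 => /(_ isT).
move=> e0.
have e2 : 0 < e / 2 by rewrite divr_gt0.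
pose near_e k l : set 'rV[R]_n :=
  [set y | `|pderiv k (pderiv l f) x - pderiv k (pderiv l f) y| < e / 2]%classic.
have near_eP k l : nbhs x (near_e k l).
  by have /cvgrPdist_lt/(_ _ e2) := cont k l.
pose A := (U `&` (near_e i j `&` near_e j i))%classic.
have Ax : nbhs x A.
  by apply: filterI; [exact: open_nbhs_nbhs|apply: filterI; exact: near_eP].
have [r /= r0 rA] := (nbhs_ballP _ _).1 Ax.
pose u : 'rV[R]_n := delta_mx 0 i; pose v : 'rV[R]_n := delta_mx 0 j.
have N0 : 0 < `|u| + `|v| + 1 by rewrite ltr_wpDl// addr_ge0.
(* the denominator makes the parallelogram of side h fit in the ball of radius r;
   the summand 1 only keeps it positive *)
pose h := r / (`|u| + `|v| + 1).
have h0 : 0 < h by rewrite divr_gt0.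
have Ah (s t : R) : 0 <= s <= h -> 0 <= t <= h -> A (x + s *: u + t *: v).
  move=> /andP[s0 sh] /andP[t0 th]; apply: rA; rewrite -ball_normE /=.
  rewrite -addrA opprD addrA subrr add0r normrN.
  apply: (le_lt_trans (ler_normD _ _)); rewrite !normrZ !ger0_norm//.
  apply: (@le_lt_trans _ _ (h * (`|u| + `|v|))).
    by rewrite mulrDr lerD// ler_wpM2r.
  by rewrite /h mulrAC ltr_pdivrMr// ltr_pM2l// ltrDl.
have [||p [_ [_ Ap]] Ep] := @second_difference f x u v h A h0 Ah.
- by move=> y [Uy _]; exact: df.
- by move=> y [Uy _]; have [_ [+ _]] := Df i; exact.
have [|||q [_ [Aq _]] Eq] := @second_difference f x v u h A h0.
- by move=> s t sh th; rewrite addrAC; exact: Ah.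
- by move=> y [Uy _]; exact: df.
- by move=> y [Uy _]; have [_ [+ _]] := Df j; exact.
have Epq : pderiv i (pderiv j f) q = pderiv j (pderiv i f) p.
  apply: (@mulfI _ (h ^+ 2)); first by rewrite expf_neq0// gt_eqF.
  rewrite -[LHS]Eq -[RHS]Ep [x + h *: v + _]addrAC; ring.
rewrite /near_e /= in Ap Aq.
by rewrite -Epq in Ap; exact: close Aq Ap.
Qed.

End MixedPartials.

(** * Sums against Kronecker symbols and calculus of partial derivatives *)

Section KroneckerSums.
Variables (R : pzRingType) (I : finType).
Implicit Types (F : I -> R) (c : I).

Lemma sumr_deltar F c : \sum_d F d * (c == d)%:R = F c.
Proof.
rewrite (bigD1 c) //= eqxx mulr1 big1 ?addr0// => d.
by rewrite eq_sym => /negbTE ->; rewrite mulr0.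
Qed.

Lemma sumr_deltal F c : \sum_d F d * (d == c)%:R = F c.
Proof. by under eq_bigr do rewrite eq_sym; exact: sumr_deltar. Qed.

End KroneckerSums.

Section PartialDerivatives.
Variables (R : realType) (n : nat) (U : set 'rV[R]_n).
Hypothesis oU : open U.
Implicit Types (f g : 'rV[R]_n -> R) (x : 'rV[R]_n) (i : 'I_n).

Lemma Ck_derivable k f x i :
  Ck k.+1 U f -> U x -> derivable f x (delta_mx 0 i).
Proof. by move=> [_ [df _]]; exact: df. Qed.

Lemma Ck_pderiv k f i : Ck k.+1 U f -> Ck k U (pderiv i f).
Proof. by move=> [_ [_ Df]]; exact: Df. Qed.

Lemma pderiv_eq_on f g x i : U x -> (forall y, U y -> f y = g y) ->
  pderiv i f x = pderiv i g x.
Proof.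
move=> Ux fg; apply: near_eq_derive.
by have := open_nbhs_nbhs (conj oU Ux); apply: filterS.
Qed.

Lemma pderivD f g x i : Ck 1 U f -> Ck 1 U g -> U x ->
  pderiv i (fun y => f y + g y) x = pderiv i f x + pderiv i g x.
Proof.
by move=> Cf Cg Ux; rewrite /pderiv; apply: deriveD;
  [exact: Ck_derivable Cf Ux|exact: Ck_derivable Cg Ux].
Qed.

Lemma pderivM f g x i : Ck 1 U f -> Ck 1 U g -> U x ->
  pderiv i (fun y => f y * g y) x = f x * pderiv i g x + g x * pderiv i f x.
Proof.
by move=> Cf Cg Ux; rewrite /pderiv; apply: deriveM;
  [exact: Ck_derivable Cf Ux|exact: Ck_derivable Cg Ux].
Qed.

Lemma pderivZ f x i (c : R) : Ck 1 U f -> U x ->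
  pderiv i (fun y => c * f y) x = c * pderiv i f x.
Proof.
by move=> Cf Ux; rewrite (pderivM _ (Ck_cst 1 U c) Cf Ux) pderiv_cst mulr0 addr0.
Qed.

Lemma pderiv_lincomb f1 f2 f3 x i (a b c : R) :
  Ck 1 U f1 -> Ck 1 U f2 -> Ck 1 U f3 -> U x ->
  pderiv i (fun y => a * f1 y + b * f2 y + c * f3 y) x =
  a * pderiv i f1 x + b * pderiv i f2 x + c * pderiv i f3 x.
Proof.
move=> C1 C2 C3 Ux.
have Ca := Ck_M oU (Ck_cst 1 U a) C1; have Cb := Ck_M oU (Ck_cst 1 U b) C2.
have Cc := Ck_M oU (Ck_cst 1 U c) C3.
rewrite (pderivD i (Ck_D oU Ca Cb) Cc Ux) (pderivD i Ca Cb Ux).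
by rewrite (pderivZ i a C1 Ux) (pderivZ i b C2 Ux) (pderivZ i c C3 Ux).
Qed.

Lemma pderiv_div f g x i : Ck 1 U f -> Ck 1 U g ->
  (forall y, U y -> g y != 0) -> U x ->
  pderiv i (fun y => f y / g y) x =
  pderiv i f x / g x - f x * pderiv i g x / g x ^+ 2.
Proof.
move=> Cf Cg g0 Ux; rewrite (pderivM _ Cf (Ck_V oU g0 Cg) Ux).
rewrite {1}/pderiv deriveV; [|exact: g0|exact: Ck_derivable Cg Ux].
rewrite -[_ *: _]/(_ * _) -/(pderiv i g x).
by field; exact: g0.
Qed.

Lemma Ck_sum k (I : Type) (r : seq I) (F : I -> 'rV[R]_n -> R) :
  (forall a, Ck k U (F a)) -> Ck k U (fun x => \sum_(a <- r) F a x).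
Proof.
move=> CF; elim: r => [|a r IH].
  by apply: (Ck_ext oU _ (Ck_cst k U 0)) => x _; rewrite big_nil.
by apply: (Ck_ext oU _ (Ck_D oU (CF a) IH)) => x _; rewrite big_cons.
Qed.

Lemma Ck_prod k (I : Type) (r : seq I) (F : I -> 'rV[R]_n -> R) :
  (forall a, Ck k U (F a)) -> Ck k U (fun x => \prod_(a <- r) F a x).
Proof.
move=> CF; elim: r => [|a r IH].
  by apply: (Ck_ext oU _ (Ck_cst k U 1)) => x _; rewrite big_nil.
by apply: (Ck_ext oU _ (Ck_M oU (CF a) IH)) => x _; rewrite big_cons.
Qed.

Lemma Ck_det k q (A : 'rV[R]_n -> 'M[R]_q) :
  (forall a b, Ck k U (fun x => A x a b)) -> Ck k U (fun x => \det (A x)).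
Proof.
move=> CA; rewrite /determinant; apply: Ck_sum => s.
by apply: (Ck_M oU (Ck_cst k U _)); apply: Ck_prod => a; exact: CA.
Qed.

(** By Cramer's rule the inverse is the adjugate divided by the determinant,
    both polynomial in the entries. *)
Lemma Ck_invmx k q (A : 'rV[R]_n -> 'M[R]_q) a b :
  (forall x, U x -> A x \in unitmx) ->
  (forall a b, Ck k U (fun x => A x a b)) -> Ck k U (fun x => invmx (A x) a b).
Proof.
move=> uA CA.
have Cadj : Ck k U (fun x => (\adj (A x)) a b).
  apply: (Ck_ext (f := fun x => (-1) ^+ (b + a) * \det (row' b (col' a (A x)))) oU).
    by move=> x _; rewrite mxE.
  apply: (Ck_M oU (Ck_cst k U _)); apply: Ck_det => c d.
  by apply: (Ck_ext oU _ (CA (lift b c) (lift a d))) => x _; rewrite !mxE.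
have det_neq0 x : U x -> \det (A x) != 0.
  by move=> /uA; rewrite unitmxE unitfE.
apply: (Ck_ext oU _ (Ck_M oU (Ck_V oU det_neq0 (Ck_det CA)) Cadj)) => x Ux.
by rewrite /invmx (uA _ Ux) [RHS]mxE.
Qed.

End PartialDerivatives.

(** * Ricci tensor of a warped product *)

Section WarpedRicci.
Variables (R : realType) (n m : nat).

(** [k]-th contravariant component *)
Definition gradient (g : 'rV[R]_n -> 'M[R]_n) (f : 'rV[R]_n -> R) (k : 'I_n)
    (x : 'rV[R]_n) : R :=
  \sum_l invmx (g x) k l * pderiv l f x.

(** The divergence of the gradient; [christoffel g i i p] summed over [i] is
    the logarithmic derivative of the volume density along [p]. *)
Definition laplacian (g : 'rV[R]_n -> 'M[R]_n) (f : 'rV[R]_n -> R)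
    (x : 'rV[R]_n) : R :=
  \sum_i (pderiv i (gradient g f i) x
          + \sum_p christoffel g i i p x * gradient g f p x).

Definition hessian (g : 'rV[R]_n -> 'M[R]_n) (f : 'rV[R]_n -> R) (j k : 'I_n)
    (x : 'rV[R]_n) : R :=
  pderiv j (pderiv k f) x - \sum_p christoffel g p j k x * pderiv p f x.

Definition warped_mx (g : 'rV[R]_n -> 'M[R]_n) (f : 'rV[R]_n -> R)
    (h : 'rV[R]_m -> 'M[R]_m) (z : 'rV[R]_(n + m)) : 'M[R]_(n + m) :=
  block_mx (g (lsubmx z)) 0 0 (f (lsubmx z) ^+ 2 *: h (rsubmx z)).

Variables (g : 'rV[R]_n -> 'M[R]_n) (f : 'rV[R]_n -> R)
  (h : 'rV[R]_m -> 'M[R]_m).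
Variables (U : set 'rV[R]_n) (V : set 'rV[R]_m).
Hypotheses (oU : open U) (oV : open V).
Hypotheses (g_C1 : forall i j, Ck 1 U (fun x => g x i j))
  (g_unit : forall x, U x -> g x \in unitmx).
Hypotheses (f_C2 : Ck 2 U f) (f_neq0 : forall x, U x -> f x != 0).
Hypotheses (h_C1 : forall a b, Ck 1 V (fun y => h y a b))
  (h_unit : forall y, V y -> h y \in unitmx)
  (h_sym : forall y, V y -> (h y)^T = h y).

Let f_C1 : Ck 1 U f := Ck_drop f_C2.

Let W := warped_mx g f h.
Let UV : set 'rV[R]_(n + m) := [set z | U (lsubmx z) /\ V (rsubmx z)]%classic.

Lemma open_UV : open UV.
Proof.
apply: openI; first by apply: open_comp oU => z _; exact: continuous_lsubmx.
by apply: open_comp oV => z _; exact: continuous_rsubmx.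
Qed.

Lemma pderiv_prod_l (F : 'rV[R]_n -> R) (H : 'rV[R]_m -> R) z p :
  Ck 1 U F -> Ck 1 V H -> UV z ->
  pderiv (lshift m p) (fun y => F (lsubmx y) * H (rsubmx y)) z
  = pderiv p F (lsubmx z) * H (rsubmx z).
Proof.
move=> CF CH Uz.
have CFl := Ck_sub (@subIsetl _ _ _) (Ck_lsubmx m CF).
have CHr := Ck_sub (@subIsetr _ _ _) (Ck_rsubmx n CH).
rewrite (pderivM _ (CFl _) (CHr _) Uz) pderiv_lsubmx_l pderiv_rsubmx_l mulr0 add0r.
exact: mulrC.
Qed.

Lemma pderiv_prod_r (F : 'rV[R]_n -> R) (H : 'rV[R]_m -> R) z a :
  Ck 1 U F -> Ck 1 V H -> UV z ->
  pderiv (rshift n a) (fun y => F (lsubmx y) * H (rsubmx y)) z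
  = F (lsubmx z) * pderiv a H (rsubmx z).
Proof.
move=> CF CH Uz.
have CFl := Ck_sub (@subIsetl _ _ _) (Ck_lsubmx m CF).
have CHr := Ck_sub (@subIsetr _ _ _) (Ck_rsubmx n CH).
by rewrite (pderivM _ (CFl _) (CHr _) Uz) pderiv_lsubmx_r pderiv_rsubmx_r mulr0 addr0.
Qed.

(** In the names below, [l] stands for an index of the base (left block) and [r]
    for one of the fiber (right block). *)
Lemma warped_ll i j : (fun z => W z (lshift m i) (lshift m j)) =
  (fun x => g x i j) \o lsubmx.
Proof. by apply/funext => z; rewrite /W /warped_mx block_mxEul. Qed.

Lemma warped_lr i b : (fun z => W z (lshift m i) (rshift n b)) = fun=> 0.
Proof. by apply/funext => z; rewrite /W /warped_mx block_mxEur mxE. Qed.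

Lemma warped_rl a j : (fun z => W z (rshift n a) (lshift m j)) = fun=> 0.
Proof. by apply/funext => z; rewrite /W /warped_mx block_mxEdl mxE. Qed.

Lemma warped_rr a b : (fun z => W z (rshift n a) (rshift n b)) =
  fun z => (f (lsubmx z) * f (lsubmx z)) * h (rsubmx z) a b.
Proof.
by apply/funext => z; rewrite /W /warped_mx block_mxEdr mxE expr2.
Qed.

Lemma pderiv_warped_rr_l z p a b : UV z ->
  pderiv (lshift m p) (fun z => W z (rshift n a) (rshift n b)) z =
  2 * f (lsubmx z) * pderiv p f (lsubmx z) * h (rsubmx z) a b.
Proof.
move=> Uz; rewrite warped_rr.
rewrite (pderiv_prod_l (F := fun x => f x * f x) _ (Ck_M oU f_C1 f_C1) (h_C1 a b) Uz).
rewrite (pderivM _ f_C1 f_C1 Uz.1); ring.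
Qed.

Lemma pderiv_warped_rr_r z c a b : UV z ->
  pderiv (rshift n c) (fun z => W z (rshift n a) (rshift n b)) z =
  f (lsubmx z) ^+ 2 * pderiv c (fun y => h y a b) (rsubmx z).
Proof.
move=> Uz; rewrite warped_rr expr2.
exact: (pderiv_prod_r (F := fun x => f x * f x) _ (Ck_M oU f_C1 f_C1) (h_C1 a b) Uz).
Qed.

Lemma invmx_warped z : UV z -> invmx (W z) =
  block_mx (invmx (g (lsubmx z))) 0 0
    (f (lsubmx z) ^- 2 *: invmx (h (rsubmx z))).
Proof.
move=> [Ux Vy]; have f2 : f (lsubmx z) ^+ 2 != 0 by rewrite expf_neq0 ?f_neq0.
have fh : f (lsubmx z) ^+ 2 *: h (rsubmx z) \in unitmx.
  by rewrite unitmxZ ?unitfE// h_unit.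
rewrite /W /warped_mx invmx_block_diag ?invmxZ//.
by rewrite unitmxE det_ublock unitrM -!unitmxE g_unit.
Qed.

Lemma christoffel_warped_l k s t z : UV z ->
  christoffel W (lshift m k) s t z =
  2^-1 * \sum_l invmx (g (lsubmx z)) k l *
    (pderiv s (fun y => W y t (lshift m l)) z
     + pderiv t (fun y => W y s (lshift m l)) z
     - pderiv (lshift m l) (fun y => W y s t) z).
Proof.
move=> Uz; rewrite /christoffel (invmx_warped Uz) big_split_ord /=.
rewrite [X in _ + X]big1 ?addr0; last first.
  by move=> b _; rewrite block_mxEur mxE mul0r.
by congr (_ * _); apply: eq_bigr => l _; rewrite block_mxEul.
Qed.

Lemma christoffel_warped_r c s t z : UV z ->
  christoffel W (rshift n c) s t z =
  2^-1 * \sum_d f (lsubmx z) ^- 2 * invmx (h (rsubmx z)) c d *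
    (pderiv s (fun y => W y t (rshift n d)) z
     + pderiv t (fun y => W y s (rshift n d)) z
     - pderiv (rshift n d) (fun y => W y s t) z).
Proof.
move=> Uz; rewrite /christoffel (invmx_warped Uz) big_split_ord /=.
rewrite [X in X + _]big1 ?add0r; last first.
  by move=> b _; rewrite block_mxEdl mxE mul0r.
by congr (_ * _); apply: eq_bigr => l _; rewrite block_mxEdr mxE.
Qed.

Lemma christoffel_lll k i j z : UV z ->
  christoffel W (lshift m k) (lshift m i) (lshift m j) z =
  (christoffel g k i j \o lsubmx) z.
Proof.
move=> Uz; rewrite christoffel_warped_l// /christoffel /=; congr (_ * _).
by apply: eq_bigr => l _; rewrite !warped_ll !pderiv_lsubmx_l.
Qed.

Lemma christoffel_llr k i b z : UV z ->
  christoffel W (lshift m k) (lshift m i) (rshift n b) z = 0.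
Proof.
move=> Uz; rewrite christoffel_warped_l// big1 ?mulr0// => l _.
by rewrite !warped_rl !warped_ll !warped_lr pderiv_lsubmx_r !pderiv_cst !addr0 subr0 mulr0.
Qed.

Lemma christoffel_lrl k a j z : UV z ->
  christoffel W (lshift m k) (rshift n a) (lshift m j) z = 0.
Proof.
move=> Uz; rewrite christoffel_warped_l// big1 ?mulr0// => l _.
by rewrite !warped_rl !warped_ll pderiv_lsubmx_r !pderiv_cst !addr0 subr0 mulr0.
Qed.

(** The fibers are not totally geodesic: their second fundamental form is
    [- f grad f] times the metric of the fiber, because [f^2] is the only
    part of the fiber block that varies along the base. *)
Lemma christoffel_lrr k a b z : UV z ->
  christoffel W (lshift m k) (rshift n a) (rshift n b) z =
  (- (f (lsubmx z) * gradient g f k (lsubmx z))) * h (rsubmx z) a b.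
Proof.
move=> Uz; rewrite christoffel_warped_l// /gradient !mulr_sumr mulNr mulr_suml -sumrN.
apply: eq_bigr => l _.
by rewrite !warped_rl !pderiv_cst (pderiv_warped_rr_l _ _ _ Uz); field.
Qed.

Lemma christoffel_rll c i j z : UV z ->
  christoffel W (rshift n c) (lshift m i) (lshift m j) z = 0.
Proof.
move=> Uz; rewrite christoffel_warped_r// big1 ?mulr0// => l _.
by rewrite !warped_lr !warped_ll pderiv_lsubmx_r !pderiv_cst !addr0 subr0 mulr0.
Qed.

Lemma invmx_mul_sym c b y : V y -> \sum_d invmx (h y) c d * h y b d = (c == b)%:R.
Proof.
move=> Vy; have := congr1 (fun M : 'M[R]_m => M c b) (mulVmx (h_unit Vy)).
rewrite !mxE => <-; apply: eq_bigr => d _; congr (_ * _).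
by rewrite -{1}(h_sym Vy) mxE.
Qed.

(** Along the base, the coordinate fields of the fiber have a length proportional
    to [f], whence its logarithmic derivative. *)
Lemma christoffel_rlr c i b z : UV z ->
  christoffel W (rshift n c) (lshift m i) (rshift n b) z =
  (pderiv i f (lsubmx z) / f (lsubmx z)) * (c == b)%:R.
Proof.
move=> Uz; rewrite christoffel_warped_r// -(invmx_mul_sym _ _ Uz.2).
rewrite !mulr_sumr; apply: eq_bigr => d _.
rewrite !warped_lr !pderiv_cst (pderiv_warped_rr_l _ _ _ Uz).
by field; exact: f_neq0 Uz.1.
Qed.

Lemma christoffel_rrl c a j z : UV z ->
  christoffel W (rshift n c) (rshift n a) (lshift m j) z =
  (pderiv j f (lsubmx z) / f (lsubmx z)) * (c == a)%:R.
Proof.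
move=> Uz; rewrite christoffel_warped_r// -(invmx_mul_sym _ _ Uz.2).
rewrite !mulr_sumr; apply: eq_bigr => d _.
rewrite !warped_lr !warped_rl !pderiv_cst (pderiv_warped_rr_l _ _ _ Uz).
by field; exact: f_neq0 Uz.1.
Qed.

Lemma christoffel_rrr c a b z : UV z ->
  christoffel W (rshift n c) (rshift n a) (rshift n b) z =
  (christoffel h c a b \o rsubmx) z.
Proof.
move=> Uz; rewrite christoffel_warped_r// /christoffel /=; congr (_ * _).
apply: eq_bigr => d _; rewrite !(pderiv_warped_rr_r _ _ _ Uz).
by field; exact: f_neq0 Uz.1.
Qed.

Lemma pderiv_christoffel_lll s k i j z : UV z ->
  pderiv s (christoffel W (lshift m k) (lshift m i) (lshift m j)) z =
  pderiv s (christoffel g k i j \o lsubmx) z.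
Proof.
by move=> Uz; apply: (pderiv_eq_on open_UV) => // y Uy; exact: christoffel_lll.
Qed.

Lemma pderiv_christoffel_llr s k i b z : UV z ->
  pderiv s (christoffel W (lshift m k) (lshift m i) (rshift n b)) z = 0.
Proof.
move=> Uz; rewrite (pderiv_eq_on open_UV _ Uz (g := fun=> 0)) ?pderiv_cst//.
by move=> y Uy; exact: christoffel_llr.
Qed.

Lemma pderiv_christoffel_lrl s k a j z : UV z ->
  pderiv s (christoffel W (lshift m k) (rshift n a) (lshift m j)) z = 0.
Proof.
move=> Uz; rewrite (pderiv_eq_on open_UV _ Uz (g := fun=> 0)) ?pderiv_cst//.
by move=> y Uy; exact: christoffel_lrl.
Qed.

Lemma pderiv_christoffel_rll s c i j z : UV z ->
  pderiv s (christoffel W (rshift n c) (lshift m i) (lshift m j)) z = 0.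
Proof.
move=> Uz; rewrite (pderiv_eq_on open_UV _ Uz (g := fun=> 0)) ?pderiv_cst//.
by move=> y Uy; exact: christoffel_rll.
Qed.

(** This regularity is what allows the product rule on [christoffel_lrr]. *)
Lemma Ck_gradient k : Ck 1 U (gradient g f k).
Proof.
apply: (Ck_sum oU) => l; apply: (Ck_M oU); first exact: Ck_invmx.
exact: Ck_pderiv f_C2.
Qed.

Lemma pderiv_christoffel_lrr p k a b z : UV z ->
  pderiv (lshift m p) (christoffel W (lshift m k) (rshift n a) (rshift n b)) z =
  - (f (lsubmx z) * pderiv p (gradient g f k) (lsubmx z)
     + gradient g f k (lsubmx z) * pderiv p f (lsubmx z)) * h (rsubmx z) a b.
Proof.
move=> Uz; rewrite (pderiv_eq_on open_UV _ Uz (fun y => @christoffel_lrr k a b y)).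
have Cq := Ck_M oU f_C1 (Ck_gradient k).
have CNq : Ck 1 U (fun x => - (f x * gradient g f k x)).
  by apply: (Ck_ext oU _ (Ck_M oU (Ck_cst 1 U (-1)) Cq)) => x _; rewrite mulN1r.
rewrite (pderiv_prod_l _ CNq (h_C1 a b) Uz); congr (_ * _).
rewrite -(pderivM _ f_C1 (Ck_gradient k) Uz.1).
rewrite -[RHS]mulN1r -(pderivZ _ _ Cq Uz.1); congr (pderiv p _ _).
by apply/funext => x; rewrite mulN1r.
Qed.

Lemma pderiv_christoffel_rlr s c i b z : UV z ->
  pderiv s (christoffel W (rshift n c) (lshift m i) (rshift n b)) z =
  pderiv s ((fun x => pderiv i f x / f x * (c == b)%:R) \o lsubmx) z.
Proof.
by move=> Uz; apply: (pderiv_eq_on open_UV) => // y Uy; exact: christoffel_rlr.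
Qed.

Lemma pderiv_christoffel_rrl s c a j z : UV z ->
  pderiv s (christoffel W (rshift n c) (rshift n a) (lshift m j)) z =
  pderiv s ((fun x => pderiv j f x / f x * (c == a)%:R) \o lsubmx) z.
Proof.
by move=> Uz; apply: (pderiv_eq_on open_UV) => // y Uy; exact: christoffel_rrl.
Qed.

Lemma pderiv_christoffel_rrr s c a b z : UV z ->
  pderiv s (christoffel W (rshift n c) (rshift n a) (rshift n b)) z =
  pderiv s (christoffel h c a b \o rsubmx) z.
Proof.
by move=> Uz; apply: (pderiv_eq_on open_UV) => // y Uy; exact: christoffel_rrr.
Qed.

(* an index in block form selects its case syntactically, so that one rewriting
   rule evaluates every Christoffel symbol, or every derivative, of a formula *)
Let christoffelE z (Uz : UV z) :=
  (fun k i j => @christoffel_lll k i j z Uz, fun k i b => @christoffel_llr k i b z Uz,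
   fun k a j => @christoffel_lrl k a j z Uz, fun k a b => @christoffel_lrr k a b z Uz,
   fun c i j => @christoffel_rll c i j z Uz, fun c i b => @christoffel_rlr c i b z Uz,
   fun c a j => @christoffel_rrl c a j z Uz, fun c a b => @christoffel_rrr c a b z Uz).

Let pderiv_christoffelE z (Uz : UV z) :=
  (fun s k i j => @pderiv_christoffel_lll s k i j z Uz,
   fun s k i b => @pderiv_christoffel_llr s k i b z Uz,
   fun s k a j => @pderiv_christoffel_lrl s k a j z Uz,
   fun s k a b => @pderiv_christoffel_lrr s k a b z Uz,
   fun s c i j => @pderiv_christoffel_rll s c i j z Uz,
   fun s c i b => @pderiv_christoffel_rlr s c i b z Uz,
   fun s c a j => @pderiv_christoffel_rrl s c a j z Uz,
   fun s c a b => @pderiv_christoffel_rrr s c a b z Uz).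

Lemma riemann_warped_llll l i j k z : UV z ->
  riemann W (lshift m l) (lshift m i) (lshift m j) (lshift m k) z =
  riemann g l i j k (lsubmx z).
Proof.
move=> Uz; rewrite /riemann !(pderiv_christoffelE Uz) !pderiv_lsubmx_l big_split_ord /=.
rewrite [X in _ + (_ + X)]big1 ?addr0.
  by congr (_ + _); apply: eq_bigr => p _; rewrite !(christoffelE Uz).
by move=> c _; rewrite !(christoffelE Uz) !mul0r subrr.
Qed.

(** Each fiber direction contributes the same amount, so the trace over the
    fiber yields the factor [m] of the Hessian term. *)
Lemma riemann_warped_rrll c j k z : UV z ->
  riemann W (rshift n c) (rshift n c) (lshift m j) (lshift m k) z =
  - (hessian g f j k (lsubmx z) / f (lsubmx z)).
Proof.
move=> Uz; rewrite /riemann !(pderiv_christoffelE Uz) !pderiv_lsubmx_l big_split_ord /=.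
rewrite eqxx (_ : (fun x => _) = fun x => pderiv k f x / f x); last first.
  by apply/funext => x; rewrite mulr1.
rewrite (pderiv_div oU _ (Ck_pderiv k f_C2) f_C1 f_neq0 Uz.1).
have -> : \sum_p (christoffel W (rshift n c) (rshift n c) (lshift m p) z
      * christoffel W (lshift m p) (lshift m j) (lshift m k) z
    - christoffel W (rshift n c) (lshift m j) (lshift m p) z
      * christoffel W (lshift m p) (rshift n c) (lshift m k) z) =
    (\sum_p christoffel g p j k (lsubmx z) * pderiv p f (lsubmx z)) / f (lsubmx z).
  rewrite mulr_suml; apply: eq_bigr => p _.
  by rewrite !(christoffelE Uz) eqxx /=; ring.
have -> : \sum_d (christoffel W (rshift n c) (rshift n c) (rshift n d) z
      * christoffel W (rshift n d) (lshift m j) (lshift m k) z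
    - christoffel W (rshift n c) (lshift m j) (rshift n d) z
      * christoffel W (rshift n d) (rshift n c) (lshift m k) z) =
    - (pderiv j f (lsubmx z) / f (lsubmx z) * (pderiv k f (lsubmx z) / f (lsubmx z))).
  rewrite -[RHS](sumr_deltar (fun=> _) c); apply: eq_bigr => d _.
  by rewrite !(christoffelE Uz) eq_sym; case: eqP => _ /=; ring.
by rewrite /hessian; field; exact: f_neq0 Uz.1.
Qed.

Lemma riemann_warped_lllr i j b z : UV z ->
  riemann W (lshift m i) (lshift m i) (lshift m j) (rshift n b) z = 0.
Proof.
move=> Uz; rewrite /riemann !(pderiv_christoffelE Uz) subrr add0r big_split_ord /=.
by rewrite !big1 ?addr0// => p _; rewrite !(christoffelE Uz) ?mulr0 ?mul0r subrr.
Qed.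

Lemma riemann_warped_rrlr c j b z : UV z ->
  riemann W (rshift n c) (rshift n c) (lshift m j) (rshift n b) z = 0.
Proof.
move=> Uz; rewrite /riemann !(pderiv_christoffelE Uz).
rewrite pderiv_lsubmx_r pderiv_rsubmx_l subrr add0r big_split_ord /=.
rewrite big1 ?add0r; last first.
  by move=> p _; rewrite !(christoffelE Uz) mulr0 mul0r subrr.
under eq_bigr do rewrite !(christoffelE Uz) mulrA [X in _ - X]mulrAC.
rewrite sumrB sumr_deltal sumr_deltar mulrC.
exact: subrr.
Qed.

Lemma riemann_warped_llrl i a j z : UV z ->
  riemann W (lshift m i) (lshift m i) (rshift n a) (lshift m j) z = 0.
Proof.
move=> Uz; rewrite /riemann !(pderiv_christoffelE Uz) pderiv_lsubmx_r subrr add0r.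
rewrite big_split_ord /=.
by rewrite !big1 ?addr0// => p _; rewrite !(christoffelE Uz) ?mulr0 ?mul0r subrr.
Qed.

Lemma christoffel_sym c a b y : V y -> christoffel h c a b y = christoffel h c b a y.
Proof.
move=> Vy; rewrite /christoffel; congr (_ * _); apply: eq_bigr => d _.
have -> : pderiv d (fun y => h y a b) y = pderiv d (fun y => h y b a) y.
  by apply: (pderiv_eq_on oV) => // w Vw; rewrite -[in LHS](h_sym Vw) mxE.
by rewrite [X in X - _]addrC.
Qed.

(** The two quadratic terms cancel only after summation, and by the symmetry
    of the fiber connection. *)
Lemma riemann_warped_rrrl c a j z : UV z ->
  riemann W (rshift n c) (rshift n c) (rshift n a) (lshift m j) z = 0.
Proof.
move=> Uz; rewrite /riemann !(pderiv_christoffelE Uz).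
rewrite !pderiv_lsubmx_r subrr add0r big_split_ord /=.
rewrite big1 ?add0r; last first.
  by move=> p _; rewrite !(christoffelE Uz) !mulr0 subrr.
under eq_bigr do rewrite !(christoffelE Uz) !mulrA.
rewrite sumrB !sumr_deltal /= (christoffel_sym _ _ _ Uz.2).
exact: subrr.
Qed.

(** The product rule creates a term [grad f . df] that is cancelled by the
    path through a fiber index; what remains sums to [- f Lap f]. *)
Lemma riemann_warped_llrr i a b z : UV z ->
  riemann W (lshift m i) (lshift m i) (rshift n a) (rshift n b) z =
  - (f (lsubmx z) * (pderiv i (gradient g f i) (lsubmx z)
     + \sum_p christoffel g i i p (lsubmx z) * gradient g f p (lsubmx z)))
  * h (rsubmx z) a b.
Proof.
move=> Uz; rewrite /riemann !(pderiv_christoffelE Uz) subr0 big_split_ord /=.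
have -> : \sum_p (christoffel W (lshift m i) (lshift m i) (lshift m p) z
      * christoffel W (lshift m p) (rshift n a) (rshift n b) z
    - christoffel W (lshift m i) (rshift n a) (lshift m p) z
      * christoffel W (lshift m p) (lshift m i) (rshift n b) z) =
    - f (lsubmx z) * h (rsubmx z) a b
    * \sum_p christoffel g i i p (lsubmx z) * gradient g f p (lsubmx z).
  by rewrite mulr_sumr; apply: eq_bigr => p _; rewrite !(christoffelE Uz) /=; ring.
have -> : \sum_d (christoffel W (lshift m i) (lshift m i) (rshift n d) z
      * christoffel W (rshift n d) (rshift n a) (rshift n b) z
    - christoffel W (lshift m i) (rshift n a) (rshift n d) z
      * christoffel W (rshift n d) (lshift m i) (rshift n b) z) =
    gradient g f i (lsubmx z) * pderiv i f (lsubmx z) * h (rsubmx z) a b.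
  rewrite -[RHS](sumr_deltal (fun d => gradient g f i (lsubmx z) *
    pderiv i f (lsubmx z) * h (rsubmx z) a d) b); apply: eq_bigr => d _.
  by rewrite !(christoffelE Uz) /=; field; exact: f_neq0 Uz.1.
ring.
Qed.

(** This is the Gauss equation for the fibers.  The Kronecker term removes one
    of the [m] fiber directions from the trace, whence [m - 1] in the Ricci
    tensor. *)
Lemma riemann_warped_rrrr c a b z : UV z ->
  riemann W (rshift n c) (rshift n c) (rshift n a) (rshift n b) z =
  riemann h c c a b (rsubmx z)
  - (\sum_p gradient g f p (lsubmx z) * pderiv p f (lsubmx z))
    * (h (rsubmx z) a b - h (rsubmx z) c b * (c == a)%:R).
Proof.
move=> Uz; rewrite /riemann !(pderiv_christoffelE Uz) !pderiv_rsubmx_r big_split_ord /=.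
have -> : \sum_p (christoffel W (rshift n c) (rshift n c) (lshift m p) z
      * christoffel W (lshift m p) (rshift n a) (rshift n b) z
    - christoffel W (rshift n c) (rshift n a) (lshift m p) z
      * christoffel W (lshift m p) (rshift n c) (rshift n b) z) =
    - (\sum_p gradient g f p (lsubmx z) * pderiv p f (lsubmx z))
    * (h (rsubmx z) a b - h (rsubmx z) c b * (c == a)%:R).
  rewrite mulNr mulr_suml -sumrN; apply: eq_bigr => p _.
  by rewrite !(christoffelE Uz) eqxx /=; field; exact: f_neq0 Uz.1.
under [X in _ + (_ + X)]eq_bigr do rewrite !(christoffelE Uz).
by rewrite mulNr addrCA addrC.
Qed.

Lemma ricci_warped_ll j k z : UV z ->
  ricci W z (lshift m j) (lshift m k) =
  ricci g (lsubmx z) j k - m%:R / f (lsubmx z) * hessian g f j k (lsubmx z).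
Proof.
move=> Uz; rewrite !mxE big_split_ord /=.
under eq_bigr do rewrite (riemann_warped_llll _ _ _ _ Uz).
under [X in _ + X]eq_bigr do rewrite (riemann_warped_rrll _ _ _ Uz).
by rewrite sumr_const card_ord -mulr_natr; ring.
Qed.

Lemma ricci_warped_lr j b z : UV z -> ricci W z (lshift m j) (rshift n b) = 0.
Proof.
move=> Uz; rewrite !mxE big_split_ord /= !big1 ?addr0// => i _.
  exact: riemann_warped_rrlr.
exact: riemann_warped_lllr.
Qed.

Lemma ricci_warped_rl a j z : UV z -> ricci W z (rshift n a) (lshift m j) = 0.
Proof.
move=> Uz; rewrite !mxE big_split_ord /= !big1 ?addr0// => i _.
  exact: riemann_warped_rrrl.
exact: riemann_warped_llrl.
Qed.

Lemma ricci_warped_rr a b z : UV z ->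
  ricci W z (rshift n a) (rshift n b) =
  ricci h (rsubmx z) a b
  - (f (lsubmx z) * laplacian g f (lsubmx z)
     + (m%:R - 1) * \sum_p gradient g f p (lsubmx z) * pderiv p f (lsubmx z))
    * h (rsubmx z) a b.
Proof.
move=> Uz; rewrite !mxE big_split_ord /=.
under eq_bigr do rewrite (riemann_warped_llrr _ _ _ Uz).
under [X in _ + X]eq_bigr do rewrite (riemann_warped_rrrr _ _ _ Uz).
rewrite sumrB -mulr_sumr sumrB sumr_deltal sumr_const card_ord -mulr_natr.
rewrite -mulr_suml sumrN -mulr_sumr /laplacian.
ring.
Qed.

(** The mixed blocks of the Ricci tensor and of the metric both vanish, so only
    the two diagonal blocks constrain. *)
Lemma ricci_warped_eqP (lam : R) z : UV z ->
  ricci W z = lam *: W z <->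
  (forall j k, ricci g (lsubmx z) j k - m%:R / f (lsubmx z) * hessian g f j k (lsubmx z)
     = lam * g (lsubmx z) j k) /\
  (forall a b, ricci h (rsubmx z) a b
     - (f (lsubmx z) * laplacian g f (lsubmx z)
        + (m%:R - 1) * \sum_p gradient g f p (lsubmx z) * pderiv p f (lsubmx z))
       * h (rsubmx z) a b
     = lam * f (lsubmx z) ^+ 2 * h (rsubmx z) a b).
Proof.
move=> Uz; split=> [E|[El Er]].
  split=> [j k|a b].
    by rewrite -(ricci_warped_ll _ _ Uz) E mxE block_mxEul.
  by rewrite -(ricci_warped_rr _ _ Uz) E mxE block_mxEdr mxE mulrA.
apply/matrixP => s t; rewrite [RHS]mxE.
case: (split_ordP s) => i ->; case: (split_ordP t) => j ->.
- by rewrite (ricci_warped_ll _ _ Uz) El block_mxEul.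
- by rewrite (ricci_warped_lr _ _ Uz) block_mxEur mxE mulr0.
- by rewrite (ricci_warped_rl _ _ Uz) block_mxEdl mxE mulr0.
- by rewrite (ricci_warped_rr _ _ Uz) Er block_mxEdr mxE mulrA.
Qed.

End WarpedRicci.

(** * Curvature of a conformally flat metric *)

Section ConformallyFlatAlgebra.
Variables (R : comPzRingType) (n : nat) (eps : 'I_n -> R).
Hypothesis eps_sq : forall i, eps i * eps i = 1.
Variables (v : 'I_n -> R) (D : 'I_n -> 'I_n -> R).

(** With [u = d log phi], these are the Christoffel symbols of [phi^-2 eps]; they
    are linear in [u], so their derivatives have the same form with [u] replaced
    by its derivative.  This reduces the Ricci tensor to an algebraic identity in
    [v] and in the matrix [D] standing for the derivatives of [v]. *)
Definition flat_christoffel (u : 'I_n -> R) (k i j : 'I_n) : R :=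
  (i == j)%:R * eps i * (eps k * u k) - u j * (k == i)%:R - u i * (k == j)%:R.

Lemma flat_christoffelE u k i j : flat_christoffel u k i j =
  (i == j)%:R * eps i * eps k * u k + (- (k == i)%:R) * u j + (- (k == j)%:R) * u i.
Proof. by rewrite /flat_christoffel; ring. Qed.

(** The trace is constant term by term: when [i = j] the first and last
    summands cancel because [eps i] squares to one. *)
Lemma flat_christoffel_trace u i j : flat_christoffel u i i j = - u j.
Proof.
rewrite /flat_christoffel eqxx; have [<-|_] := eqVneq i j; rewrite ?mulr1n ?mulr0n.
  by rewrite mul1r mulrA eps_sq; ring.
by ring.
Qed.

Lemma flat_christoffel_contract w u j k :
  \sum_p w p * flat_christoffel u p j k =
  (j == k)%:R * eps j * (\sum_p eps p * (w p * u p)) - w j * u k - w k * u j.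
Proof.
rewrite -(sumr_deltal (fun p => w p * u k) j) -(sumr_deltal (fun p => w p * u j) k).
rewrite mulr_sumr -!sumrB; apply: eq_bigr => p _; rewrite /flat_christoffel; ring.
Qed.

(** The inner sum is computed by expanding only the left factor, whose Kronecker
    symbols reduce it to a contraction and to a trace of the right factor. *)
Lemma flat_christoffel_square j k :
  \sum_i \sum_p flat_christoffel v i j p * flat_christoffel v p i k =
  (n%:R + 2) * (v j * v k)
  - 2 * ((j == k)%:R * eps j * \sum_i eps i * (v i * v i)).
Proof.
have inner i : \sum_p flat_christoffel v i j p * flat_christoffel v p i k =
    eps j * (eps i * v i * flat_christoffel v j i k)
    - (\sum_p v p * flat_christoffel v p i k) * (i == j)%:R + v j * v k.
  (* the term v j * v k is minus v j times the trace of the right factor *)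
  rewrite -[v k]opprK -(flat_christoffel_trace v i k) mulrN.
  rewrite -(sumr_deltal (fun p => eps j * (eps i * v i * flat_christoffel v p i k)) j).
  rewrite -(sumr_deltal (fun p => v j * flat_christoffel v p i k) i).
  rewrite mulr_suml -!sumrB; apply: eq_bigr => p _.
  by rewrite {1}/flat_christoffel [j == p]eq_sym [i == p]eq_sym; ring.
under eq_bigr do rewrite inner.
rewrite big_split sumrB /= sumr_deltal flat_christoffel_contract sumr_const card_ord.
have -> : \sum_i eps j * (eps i * v i * flat_christoffel v j i k) =
    - ((j == k)%:R * eps j * \sum_i eps i * (v i * v i)).
  rewrite -mulr_sumr; under eq_bigr => i _.
    rewrite (_ : _ * _ = eps j * v j * v i * (i == k)%:R - eps i * v i * v k * (i == j)%:R
      - (j == k)%:R * (eps i * (v i * v i))); last first.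
      rewrite /flat_christoffel [j == i]eq_sym.
      transitivity (eps i * eps i * (eps j * v j * v i * (i == k)%:R)
        - eps i * v i * v k * (i == j)%:R - (j == k)%:R * (eps i * (v i * v i))).
        ring.
      by rewrite eps_sq mul1r.
    over.
  rewrite !sumrB !sumr_deltal -mulr_sumr; ring.
rewrite -mulr_natr; ring.
Qed.

Lemma flat_ricci j k :
  \sum_i (flat_christoffel (D i) i j k - flat_christoffel (D j) i i k
    + \sum_p (flat_christoffel v i i p * flat_christoffel v p j k
              - flat_christoffel v i j p * flat_christoffel v p i k)) =
  (n%:R - 1) * D j k - D k j + (n%:R - 2) * (v j * v k)
  + (j == k)%:R * eps j * (\sum_i eps i * D i i
                           - (n%:R - 2) * \sum_i eps i * (v i * v i)).
Proof.
have trace i : \sum_p flat_christoffel v i i p * flat_christoffel v p j k =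
    2 * (v j * v k) - (j == k)%:R * eps j * \sum_p eps p * (v p * v p).
  under eq_bigr do rewrite flat_christoffel_trace mulNr.
  by rewrite sumrN flat_christoffel_contract; ring.
under eq_bigr do rewrite sumrB trace flat_christoffel_trace.
rewrite big_split sumrB /= [X in _ + X]sumrB flat_christoffel_square !sumr_const card_ord.
have -> : \sum_i flat_christoffel (D i) i j k =
    (j == k)%:R * eps j * (\sum_i eps i * D i i) - D j k - D k j.
  rewrite -(sumr_deltal (fun i => D i k) j) -(sumr_deltal (fun i => D i j) k).
  by rewrite mulr_sumr -!sumrB; apply: eq_bigr => i _.
rewrite -mulr_natr -[in X in _ + X]mulr_natr; ring.
Qed.

End ConformallyFlatAlgebra.

Section ConformallyFlat.
Variables (R : realType) (n : nat) (eps : 'I_n -> R) (phi : 'rV[R]_n -> R).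
Variable U : set 'rV[R]_n.
Hypotheses (oU : open U) (eps_sq : forall i, eps i * eps i = 1).
Hypotheses (phi_C2 : Ck 2 U phi) (phi_neq0 : forall x, U x -> phi x != 0).

Definition conformally_flat_mx (x : 'rV[R]_n) : 'M[R]_n :=
  phi x ^- 2 *: diag_mx (\row_i eps i).

Let g := conformally_flat_mx.
Let phi_C1 : Ck 1 U phi := Ck_drop phi_C2.
Let v (i : 'I_n) (x : 'rV[R]_n) : R := pderiv i phi x / phi x.

Lemma conformally_flat_entry i j :
  (fun x => g x i j) = (fun x => (eps i * (i == j)%:R) * (1 / (phi x * phi x))).
Proof.
apply/funext => x; rewrite !mxE div1r expr2 mulrC.
by case: eqVneq => _; rewrite ?mulr1 ?mulr0.
Qed.

Let phi2_neq0 x : U x -> phi x * phi x != 0.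
Proof. by move=> Ux; rewrite mulf_neq0 ?phi_neq0. Qed.

Lemma Ck_conformally_flat i j : Ck 1 U (fun x => g x i j).
Proof.
rewrite conformally_flat_entry; apply: (Ck_M oU (Ck_cst 1 U _)).
apply: (Ck_M oU (Ck_cst 1 U 1)); apply: (Ck_V oU phi2_neq0).
exact: (Ck_M oU phi_C1 phi_C1).
Qed.

Lemma pderiv_conformally_flat p i j x : U x ->
  pderiv p (fun y => g y i j) x =
  eps i * (i == j)%:R * (- 2 * phi x ^- 2 * v p x).
Proof.
move=> Ux; rewrite conformally_flat_entry.
have C2 := Ck_M oU phi_C1 phi_C1.
have Cinv : Ck 1 U (fun x => 1 / (phi x * phi x)).
  exact: (Ck_M oU (Ck_cst 1 U 1) (Ck_V oU phi2_neq0 C2)).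
rewrite (pderivZ _ _ Cinv Ux) (pderiv_div oU _ (Ck_cst 1 U 1) C2 phi2_neq0 Ux).
rewrite (pderivM _ phi_C1 phi_C1 Ux) pderiv_cst /v.
by congr (_ * _); field; exact: phi_neq0.
Qed.

(** The diagonal matrix of signs is its own inverse. *)
Lemma invmx_conformally_flat x : U x ->
  invmx (g x) = phi x ^+ 2 *: diag_mx (\row_i eps i).
Proof.
move=> Ux; have phi2 : phi x ^+ 2 != 0 by rewrite expf_neq0 ?phi_neq0.
have gV : (phi x ^+ 2 *: diag_mx (\row_i eps i)) *m g x = 1%:M.
  rewrite -scalemxAl -scalemxAr scalerA mulfV// scale1r mulmx_diag.
  by rewrite -diag_const_mx; congr diag_mx; apply/rowP => i; rewrite !mxE eps_sq.
have [_ gU] := mulmx1_unit gV.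
by rewrite -[invmx _]mul1mx -gV mulmxK.
Qed.

Lemma conformally_flat_unit x : U x -> g x \in unitmx.
Proof.
move=> Ux; rewrite unitmxZ ?unitfE ?invr_eq0 ?expf_neq0 ?phi_neq0//.
by have /mulmx1_unit[] : diag_mx (\row_i eps i) *m diag_mx (\row_i eps i) = 1%:M;
  first by rewrite mulmx_diag -diag_const_mx; congr diag_mx; apply/rowP => i;
    rewrite !mxE eps_sq.
Qed.

Lemma invmx_conformally_flat_contract k (F : 'I_n -> R) x : U x ->
  \sum_l invmx (g x) k l * F l = phi x ^+ 2 * eps k * F k.
Proof.
move=> Ux; rewrite (invmx_conformally_flat Ux).
rewrite -(sumr_deltar (fun l => phi x ^+ 2 * eps k * F l) k).
apply: eq_bigr => l _; rewrite !mxE.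
by case: eqP => _; rewrite ?mulr1n ?mulr0n; ring.
Qed.

Lemma christoffel_conformally_flat k i j x : U x ->
  christoffel g k i j x = flat_christoffel eps (v ^~ x) k i j.
Proof.
move=> Ux; rewrite /christoffel (invmx_conformally_flat_contract _ _ Ux).
rewrite !(pderiv_conformally_flat _ _ _ Ux) /flat_christoffel.
have phi0 := phi_neq0 Ux.
transitivity ((i == j)%:R * eps i * (eps k * v k x)
  - v j x * (eps i * eps k * (i == k)%:R) - v i x * (eps j * eps k * (j == k)%:R)).
  by move: (phi x) phi0 (v i x) (v j x) (v k x) => r r0 a b c; field.
rewrite [k == i]eq_sym [k == j]eq_sym.
have epsE a b : eps a * eps b * (a == b)%:R = (a == b)%:R.
  by case: eqP => [->|_]; rewrite ?mulr0// eps_sq mulr1.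
by rewrite !epsE.
Qed.

Lemma Ck_logderiv i : Ck 1 U (v i).
Proof. exact: (Ck_M oU (Ck_pderiv i phi_C2) (Ck_V oU phi_neq0 phi_C1)). Qed.

Lemma pderiv_christoffel_conformally_flat p k i j x : U x ->
  pderiv p (christoffel g k i j) x =
  flat_christoffel eps (fun l => pderiv p (v l) x) k i j.
Proof.
move=> Ux; rewrite (pderiv_eq_on oU _ Ux (fun y => @christoffel_conformally_flat k i j y)).
rewrite flat_christoffelE.
rewrite -(pderiv_lincomb oU _ _ _ _ (Ck_logderiv k) (Ck_logderiv j) (Ck_logderiv i) Ux).
by congr (pderiv p _ x); apply/funext => y; rewrite flat_christoffelE.
Qed.

Lemma ricci_conformally_flat j k x : U x ->
  ricci g x j k = (n%:R - 2) * (pderiv j (pderiv k phi) x / phi x)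
  + (j == k)%:R * eps j *
    ((\sum_i eps i * pderiv i (pderiv i phi) x) / phi x
     - (n%:R - 1) * (\sum_i eps i * pderiv i phi x ^+ 2) / phi x ^+ 2).
Proof.
move=> Ux; have phi0 := phi_neq0 Ux; rewrite mxE /riemann.
have dv p l : pderiv p (v l) x =
    pderiv p (pderiv l phi) x / phi x - v l x * v p x.
  rewrite (pderiv_div oU _ (Ck_pderiv l phi_C2) phi_C1 phi_neq0 Ux) /v.
  by field.
under eq_bigr => i _.
  rewrite !(pderiv_christoffel_conformally_flat _ _ _ _ Ux).
  under eq_bigr do rewrite !(christoffel_conformally_flat _ _ _ Ux).
  over.
rewrite (flat_ricci eps_sq (v ^~ x) (fun p l => pderiv p (v l) x)) !dv.
(* the two mixed derivatives of phi occur with coefficients n - 1 and -1 *)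
rewrite (pderivC k j oU phi_C2 Ux).
have -> : \sum_i eps i * pderiv i (v i) x =
    (\sum_i eps i * pderiv i (pderiv i phi) x) / phi x
    - (\sum_i eps i * pderiv i phi x ^+ 2) / phi x ^+ 2.
  rewrite !mulr_suml -sumrB; apply: eq_bigr => i _; rewrite dv /v.
  by field.
have -> : \sum_i eps i * (v i x * v i x) =
    (\sum_i eps i * pderiv i phi x ^+ 2) / phi x ^+ 2.
  by rewrite mulr_suml; apply: eq_bigr => i _; rewrite /v; field.
by rewrite /v; field.
Qed.

Variable f : 'rV[R]_n -> R.
Hypothesis f_C2 : Ck 2 U f.

Lemma hessian_conformally_flat j k x : U x ->
  hessian g f j k x = pderiv j (pderiv k f) x
  + (pderiv j phi x * pderiv k f x + pderiv k phi x * pderiv j f x) / phi x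
  - (j == k)%:R * eps j * (\sum_p eps p * pderiv p phi x * pderiv p f x) / phi x.
Proof.
move=> Ux; rewrite /hessian.
under eq_bigr do rewrite (christoffel_conformally_flat _ _ _ Ux) mulrC.
rewrite flat_christoffel_contract.
rewrite (_ : \sum_p _ = (\sum_p eps p * pderiv p phi x * pderiv p f x) / phi x).
  by rewrite /v; field; exact: phi_neq0.
by rewrite mulr_suml; apply: eq_bigr => p _; rewrite /v; field; exact: phi_neq0.
Qed.

Lemma gradient_conformally_flat k x : U x ->
  gradient g f k x = eps k * (phi x * phi x * pderiv k f x).
Proof.
by move=> Ux; rewrite /gradient (invmx_conformally_flat_contract _ _ Ux); ring.
Qed.

Lemma gradient_norm_conformally_flat x : U x ->
  \sum_p gradient g f p x * pderiv p f x =
  phi x ^+ 2 * \sum_k eps k * pderiv k f x ^+ 2.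
Proof.
move=> Ux; rewrite mulr_sumr; apply: eq_bigr => p _.
by rewrite (gradient_conformally_flat _ Ux); ring.
Qed.

Lemma laplacian_conformally_flat x : U x ->
  laplacian g f x = phi x ^+ 2 * (\sum_k eps k * pderiv k (pderiv k f) x)
  - (n%:R - 2) * phi x * (\sum_k eps k * pderiv k f x * pderiv k phi x).
Proof.
move=> Ux; rewrite /laplacian big_split /=.
have C2 := Ck_M oU phi_C1 phi_C1.
have Cg k := Ck_M oU C2 (Ck_pderiv k f_C2).
have dgrad i : pderiv i (gradient g f i) x =
    phi x ^+ 2 * (eps i * pderiv i (pderiv i f) x)
    + 2 * phi x * (eps i * pderiv i f x * pderiv i phi x).
  rewrite (pderiv_eq_on oU _ Ux (fun y => @gradient_conformally_flat i y)).
  rewrite (pderivZ _ _ (Cg i) Ux) (pderivM _ C2 (Ck_pderiv i f_C2) Ux).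
  by rewrite (pderivM _ phi_C1 phi_C1 Ux); ring.
under eq_bigr do rewrite dgrad.
rewrite big_split /= -!mulr_sumr.
have -> : \sum_(i < n) \sum_p christoffel g i i p x * gradient g f p x =
    \sum_(i < n) - (phi x * (\sum_k eps k * pderiv k f x * pderiv k phi x)).
  apply: eq_bigr => i _; rewrite mulr_sumr -sumrN; apply: eq_bigr => p _.
  rewrite (christoffel_conformally_flat _ _ _ Ux) flat_christoffel_trace//.
  by rewrite (gradient_conformally_flat _ Ux) /v; field; exact: phi_neq0.
by rewrite sumr_const card_ord -mulr_natr; ring.
Qed.

(** Multiplied by [f phi^2], the defect of the tensor equation is [phi] times
    the off-diagonal expression, plus a term carried by the diagonal. *)
Lemma base_einsteinP (mu lam : R) x : U x -> f x != 0 ->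
  (forall j k, ricci g x j k - mu / f x * hessian g f j k x = lam * g x j k) <->
  (forall i j, i != j ->
     (n%:R - 2) * f x * pderiv j (pderiv i phi) x
     - mu * phi x * pderiv j (pderiv i f) x
     - mu * pderiv i phi x * pderiv j f x
     - mu * pderiv j phi x * pderiv i f x = 0) /\
  (forall i,
     phi x * ((n%:R - 2) * f x * pderiv i (pderiv i phi) x
              - mu * phi x * pderiv i (pderiv i f) x
              - 2 * mu * pderiv i phi x * pderiv i f x)
     + eps i * (f x * phi x * (\sum_k eps k * pderiv k (pderiv k phi) x)
                - (n%:R - 1) * f x * (\sum_k eps k * pderiv k phi x ^+ 2)
                + mu * phi x * (\sum_k eps k * pderiv k phi x * pderiv k f x))
     = eps i * lam * f x).
Proof.
move=> Ux f0; have phi0 := phi_neq0 Ux.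
have c0 : (f x * phi x ^+ 2)^-1 != 0 by rewrite invr_eq0 mulf_neq0// expf_neq0.
have defect j k : ricci g x j k - mu / f x * hessian g f j k x - lam * g x j k =
    (f x * phi x ^+ 2)^-1 * (phi x * ((n%:R - 2) * f x * pderiv j (pderiv k phi) x
      - mu * phi x * pderiv j (pderiv k f) x
      - mu * pderiv k phi x * pderiv j f x - mu * pderiv j phi x * pderiv k f x)
      + (j == k)%:R * (eps j * (f x * phi x * (\sum_k eps k * pderiv k (pderiv k phi) x)
                - (n%:R - 1) * f x * (\sum_k eps k * pderiv k phi x ^+ 2)
                + mu * phi x * (\sum_k eps k * pderiv k phi x * pderiv k f x))
          - eps j * lam * f x)).
  rewrite (ricci_conformally_flat _ _ Ux) (hessian_conformally_flat _ _ Ux).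
  rewrite (congr1 (fun F => F x) (conformally_flat_entry j k)).
  move: (phi x) phi0 (f x) f0 => r r0 s s0.
  move: (pderiv j (pderiv k phi) x) (pderiv j (pderiv k f) x) => P F.
  move: (pderiv j phi x) (pderiv k phi x) (pderiv j f x) (pderiv k f x) => a b c d.
  move: (\sum_i _ * _) (\sum_i _ * _) (\sum_i _ * _) => A B C.
  by field; apply/andP.
have twice (a b c : R) : c - mu * a * b - mu * a * b = c - 2 * mu * a * b by ring.
split=> [E|[Eoff Ediag] j k].
  split=> [i j ij|i].
    have := defect j i; rewrite E subrr eq_sym (negbTE ij) mul0r addr0 => /esym/eqP.
    by rewrite !mulf_eq0 (negbTE c0) (negbTE phi0) => /eqP.
  have := defect i i; rewrite E subrr eqxx mul1r => /esym/eqP.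
  by rewrite mulf_eq0 (negbTE c0) addrA subr_eq0 twice => /eqP.
apply/eqP; rewrite -subr_eq0 defect mulf_eq0 (negbTE c0) /=.
have [<-|jk] := eqVneq j k; last first.
  by rewrite Eoff 1?eq_sym// mulr0 mul0r addr0.
by rewrite mul1r addrA subr_eq0 -Ediag twice.
Qed.

End ConformallyFlat.

(** * The Einstein equations *)

(** The index [i] witnesses that the size is positive: the empty matrix is
    invertible. *)
Lemma unitmx_entry_neq0 (R : comUnitRingType) (m : nat) (A : 'M[R]_m) (i : 'I_m) :
  A \in unitmx -> exists b, exists c, A b c != 0.
Proof.
move=> Au; have [[b c] /= Abc|A0] := pickP (fun p => A p.1 p.2 != 0).
  by exists b, c.
have := congr1 (fun M : 'M[R]_m => M i i) (mulmxV Au).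
rewrite !mxE eqxx big1 => [/esym/eqP|l _]; first by rewrite oner_eq0.
by have /negbFE/eqP /= -> := A0 (i, l); rewrite mul0r.
Qed.

Unset Implicit Arguments.
Set Strict Implicit.

Theorem theorem1p1 (R : realType) (n m : nat) (hn : (3 <= n)%N) (hm : (1 <= m)%N)
  (eps : 'I_n -> R) (heps : forall i, eps i = 1 \/ eps i = -1)
  (f phi : 'rV[R]_n -> R)
  (f_smooth : smooth_fun (M := euclidean R n) f)
  (f_gt0 : forall x, 0 < f x)
  (phi_smooth : smooth_fun (M := euclidean R n) phi)
  (phi_neq0 : forall x, phi x != 0)
  (F : semiRiemannian R m) (lamF : R) (F_einstein : einstein F lamF)
  (lam : R) :
  let gbar := conformal (M := pseudo_euclidean heps) phi_smooth phi_neq0 in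
  einstein (warped_product (B := gbar) F f_smooth f_gt0) lam <->
  [/\ forall (x : 'rV[R]_n) (i j : 'I_n), i != j ->
        (n%:R - 2) * f x * pderiv j (pderiv i phi) x
        - m%:R * phi x * pderiv j (pderiv i f) x
        - m%:R * pderiv i phi x * pderiv j f x
        - m%:R * pderiv j phi x * pderiv i f x = 0,
      forall (x : 'rV[R]_n) (i : 'I_n),
        phi x * ((n%:R - 2) * f x * pderiv i (pderiv i phi) x
                 - m%:R * phi x * pderiv i (pderiv i f) x
                 - 2 * m%:R * pderiv i phi x * pderiv i f x)
        + eps i * (f x * phi x * (\sum_k eps k * pderiv k (pderiv k phi) x)
                   - (n%:R - 1) * f x * (\sum_k eps k * pderiv k phi x ^+ 2)
                   + m%:R * phi x * (\sum_k eps k * pderiv k phi x * pderiv k f x))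
        = eps i * lam * f x
    & forall x : 'rV[R]_n,
        - f x * phi x ^+ 2 * (\sum_k eps k * pderiv k (pderiv k f) x)
        + (n%:R - 2) * f x * phi x * (\sum_k eps k * pderiv k f x * pderiv k phi x)
        - (m%:R - 1) * phi x ^+ 2 * (\sum_k eps k * pderiv k f x ^+ 2)
        = lam * f x ^+ 2 - lamF ].

Proof.
move=> gbar.
have eps_sq i : eps i * eps i = 1 by case: (heps i) => ->; ring.
have f_C2 : Ck 2 setT f := f_smooth tt 2.
have phi_C2 : Ck 2 setT phi := phi_smooth tt 2.
have oT : open (setT : set 'rV[R]_n) := openT.
have phi0 x : setT x -> phi x != 0 by move=> _; exact: phi_neq0.
have f0 x : setT x -> f x != 0 by move=> _; rewrite gt_eqF.
have baseP x := base_einsteinP oT eps_sq phi_C2 phi0 m%:R lam (I : setT x) (f0 x I).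
have warpedP (a : mf_chart F) (z : 'rV[R]_(n + m)) (az : mf_img a (rsubmx z)) :=
  ricci_warped_eqP oT (mf_img_open a)
    (Ck_conformally_flat eps oT phi_C2 phi0) (conformally_flat_unit eps_sq phi0)
    f_C2 f0 (fun i j => sr_smooth a i j 1) (fun y => @sr_nondeg _ _ F a y)
    (fun y => @sr_sym _ _ F a y) lam (conj I az).
have fiberE x : f x * laplacian (conformally_flat_mx eps phi) f x
    + (m%:R - 1) * (\sum_p gradient (conformally_flat_mx eps phi) f p x * pderiv p f x)
    = - (- f x * phi x ^+ 2 * (\sum_k eps k * pderiv k (pderiv k f) x)
        + (n%:R - 2) * f x * phi x * (\sum_k eps k * pderiv k f x * pderiv k phi x)
        - (m%:R - 1) * phi x ^+ 2 * (\sum_k eps k * pderiv k f x ^+ 2)).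
  rewrite (laplacian_conformally_flat oT eps_sq phi_C2 phi0 f_C2 (I : setT x)).
  rewrite (gradient_norm_conformally_flat eps_sq phi0 f (I : setT x)).
  move: (f x) (phi x) (\sum_k _ * _) (\sum_k _ * _) (\sum_k _ * _) => r s A B C.
  by ring.
split=> [E|[Eoff Ediag Efib]].
  (* F has a point, so over each x there is a point of the product to test *)
  have [a [y ay]] : exists (a : mf_chart F), exists y, mf_img a y.
    have [p _] := mf_nonempty F; have [a ap] := mf_cover p.
    by exists a, (mf_coord a p); exact: mf_coord_img.
  have Ex x : ricci (warped_mx (conformally_flat_mx eps phi) f (sr_metric a)) (row_mx x y)
      = lam *: warped_mx (conformally_flat_mx eps phi) f (sr_metric a) (row_mx x y).
    by apply: (E (tt, a) (row_mx x y)); split=> //=; rewrite row_mxKr.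
  have az (x : 'rV[R]_n) : mf_img a (rsubmx (row_mx x y)) by rewrite row_mxKr.
  have Elr x := (warpedP a (row_mx x y) (az x)).1 (Ex x).
  have [b [c hbc]] : exists b, exists c, sr_metric a y b c != 0.
    exact: (unitmx_entry_neq0 (Ordinal hm) (sr_nondeg ay)).
  split=> [x i j ij|x i|x].
  - by have [Ebase _] := Elr x; rewrite row_mxKl in Ebase; exact: ((baseP x).1 Ebase).1.
  - by have [Ebase _] := Elr x; rewrite row_mxKl in Ebase; exact: ((baseP x).1 Ebase).2.
  have [_ /(_ b c)] := Elr x; rewrite row_mxKl row_mxKr fiberE.
  rewrite (F_einstein a y ay) mxE mulNr opprK -mulrDl => /(mulIf hbc) <-.
  by rewrite [RHS]addrAC subrr add0r.
move=> [[] a] z [_ /= az].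
apply/(warpedP a z az).2; split=> [j k|b c].
  apply: (baseP (lsubmx z)).2; split=> [i l|i]; [exact: Eoff|exact: Ediag].
rewrite fiberE Efib (F_einstein a _ az) mxE.
ring.
Qed.
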